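(* Let $\alpha,\beta,\lambda\in(0,1)$ with $\kappa:=\alpha+\beta+\lambda<1$, and for a function $f$ on $(0,\infty)$ let $$U_{\alpha,\beta,\lambda}[f](x)=x^{-\beta}\int_0^x \frac{y^{-\alpha} f(y)\,dy}{|x-y|^{\lambda}},\qquad x\in(0,\infty).$$ Let $p_-=\frac{1}{1-\alpha}$, $p_+=\frac{1}{1-\alpha-\lambda}$; for $p\in(p_-,p_+)$ let $q=q(p)$ be defined by $1+\frac1q=\frac1p+\kappa$, with inverse function $p=p(q)$, and let $$K(\alpha,\beta,\lambda;p)=\sup_{f\in L_p(\mathbb{R}_+),\,f\neq0}\frac{|U_{\alpha,\beta,\lambda}[f]|_{q(p)}}{|f|_p}.$$ Let $1\le A<B\le\infty$ and $\psi\in\Psi(A,B)$, and suppose $(a,b):=(A,B)\cap(p_-,p_+)\neq\emptyset$. Define $\psi_{a,b}(p)=\psi(p)$ for $p\in(a,b)$ (and $0$ otherwise), and $\psi_K(q)=K(\alpha,\beta,\lambda;p(q))\cdot\psi(p(q))$ for $p(q)\in(a,b)$. Then for every measurable $f:\mathbb{R}_+\to\mathbb{R}$ with $f\in G(\psi)$, $$\|U_{\alpha,\beta,\lambda}[f]\|_{G(\psi_K)}\le 1\cdot\|f\|_{G(\psi_{a,b})},$$ and the constant $1$ is best possible.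
   Context: For a measurable function $g$ on $\mathbb{R}_+=(0,\infty)$, $|g|_p=\left(\int_0^\infty |g(x)|^p\,dx\right)^{1/p}$ is the Lebesgue $L_p$ norm. For $1\le A<B\le\infty$, $\Psi(A,B)$ is the set of continuous positive functions $\psi$ on the open interval $(A,B)$ with $\inf_{p\in(A,B)}\psi(p)>0$. The Grand Lebesgue Space $G(\psi)$ consists of all measurable $f:\mathbb{R}_+\to\mathbb{R}$ with finite norm $\|f\|_{G(\psi)}=\sup_{p\in(A,B)}|f|_p/\psi(p)$; for a function supported on a subinterval (such as $\psi_{a,b}$ on $(a,b)$, or $\psi_K$ on the set of $q$ with $p(q)\in(a,b)$), the supremum is taken over that subinterval. *)

(* Defs.v *)
From HB Require Import structures.
From mathcomp Require Import all_boot all_order all_algebra.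
From mathcomp Require Import all_classical all_reals all_analysis.
Set Implicit Arguments. Unset Strict Implicit. Unset Printing Implicit Defensive.
Import Order.TTheory GRing.Theory Num.Theory.
Import numFieldNormedType.Exports.
Local Open Scope classical_set_scope.
Local Open Scope ring_scope.

Section GLS.
Variable R : realType.
Local Open Scope ereal_scope.

Definition Rplus : set R := `]0%R, +oo[%classic.

Definition lpnorm (p : R) (g : R -> R) : \bar R :=
  poweR (\int[lebesgue_measure]_(x in Rplus) ((`|g x| `^ p)%R)%:E) (p^-1)%R.

Definition Uop (al be la : R) (f : R -> R) (x : R) : R :=
  (x `^ (- be) * Rintegral lebesgue_measure `]0%R, x[%classic
     (fun y => y `^ (- al) * f y * (`|x - y| `^ (- la))))%R.

Definition kappa (al be la : R) : R := (al + be + la)%R.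
Definition pminus (al : R) : R := (1 - al)^-1%R.
Definition pplus (al la : R) : R := (1 - al - la)^-1%R.

(* q(p) : 1 + 1/q = 1/p + kappa ; p(q) its inverse *)
Definition qofp (al be la p : R) : R := (p^-1 + kappa al be la - 1)^-1%R.
Definition pofq (al be la q : R) : R := (1 + q^-1 - kappa al be la)^-1%R.

Definition Kconst (al be la p : R) : \bar R :=
  ereal_sup [set lpnorm (qofp al be la p) (Uop al be la f) * inve (lpnorm p f)
            | f in [set f : R -> R | measurable_fun Rplus f /\
                      lpnorm p f < +oo /\ lpnorm p f != 0]].

Definition Gnorm (D : set R) (w : R -> \bar R) (g : R -> R) : \bar R :=
  ereal_sup [set lpnorm p g * inve (w p) | p in D].

Definition AB (A : R) (B : \bar R) : set R := [set p | (A < p)%R /\ p%:E < B].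

Definition in_Psi (A : R) (B : \bar R) (psi : R -> R) : Prop :=
  {within AB A B, continuous psi} /\
  (forall p, AB A B p -> (0 < psi p)%R) /\
  (exists2 c : R, (0 < c)%R & forall p, AB A B p -> (c <= psi p)%R).

Definition ab_set (al la A : R) (B : \bar R) : set R :=
  AB A B `&` [set p | (pminus al < p < pplus al la)%R].

Definition psi_ab (al la A : R) (B : \bar R) (psi : R -> R) (p : R) : R :=
  if asbool (ab_set al la A B p) then psi p else 0%R.

Definition qdom (al be la A : R) (B : \bar R) : set R :=
  [set q | ab_set al la A B (pofq al be la q)].

Definition psi_K (al be la : R) (psi : R -> R) (q : R) : \bar R :=
  Kconst al be la (pofq al be la q) * (psi (pofq al be la q))%:E.

End GLS.

(* Main.v *)
(** Put u = 1/p, v = 1/q and kappa = alpha + beta + lambda, so that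
v = u + kappa - 1, and let T be the operator U applied to nonnegative functions,
with values in [0, +oo].

The inequality is the definition of K(p), applied for each q.  It remains to see
that the constant cannot be improved.  A three-factor Hölder inequality with a
power weight (Young's inequality for the homogeneous kernel) shows that K is
finite for 1 - kappa < u < 1 - alpha.  As 1 - kappa < 1/p_+, the right endpoint
b of (A,B) /\ (p_-,p_+) is an interior point of this range, whereas p_- is not.
Applying Hölder's inequality to T(f^(1-t) g^t) shows that
log K is convex in u; so are log |g|_p and log |T g|_q for fixed g.  Hence a
bounded function g of bounded support that is nearly extremal for K(b) is nearly
extremal for all K(p) with p slightly smaller than b.  Finally, T commutes with
dilations up to constants: replacing g by g(tau .) multiplies both |g|_p and
|T g|_q by tau^(-1/p).  For large tau this factor forces the suprema defining
the grand norms to be taken over p close to b, where g is nearly extremal. *)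

Require Import Defs.
From HB Require Import structures.
From mathcomp Require Import all_boot all_order all_algebra.
From mathcomp Require Import all_classical all_reals all_analysis.
From mathcomp Require Import measurable_realfun.
From mathcomp Require Import ring lra.
Import Order.TTheory GRing.Theory Num.Theory.
Import numFieldNormedType.Exports.
Local Open Scope classical_set_scope.
Local Open Scope ring_scope.

(** * Integrals of powers *)

(** The weight psi is only bounded below: it may oscillate or blow up at b, so psi(p) cannot be
    compared with a value at b, and the exponent that nearly attains the norm of f is known only to
    be close to b. Hence a single function has to be nearly extremal for every p in a left
    neighbourhood of b, with the same psi(p) cancelling on both sides. Log-convexity provides the
    bounds on such a neighbourhood, with explicit constants. Boundedness and bounded support of g
    serve a second purpose: f must lie in G(psi) over all of (A,B), which may stick out of
    (p_-,p_+), and one bound for |g|_p valid for all p > 1 controls every exponent away from b. A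
    further obstacle is that the real-valued U takes the value 0 where its integral is infinite; U g
    and T g have equal norms only once T g is finite almost everywhere, so the finiteness of K has
    to come before anything else about K. *)

Lemma ge0_le_integral_nonmeas d (T : measurableType d) (R : realType)
    (mu : {measure set T -> \bar R}) (D : set T) (f g : T -> \bar R) :
  (forall x, D x -> 0 <= f x)%E -> (forall x, D x -> f x <= g x)%E ->
  (\int[mu]_(x in D) f x <= \int[mu]_(x in D) g x)%E.
Proof.
move=> f0 fg.
have g0 x : D x -> (0 <= g x)%E by move=> Dx; exact: le_trans (f0 _ Dx) (fg _ Dx).
(* The integral of a nonnegative function is a supremum over the simple functions below it, and
   passing from f to g enlarges this family. Integrals involving [Uop] can thus be compared without
   first proving it measurable. *)
rewrite (ge0_integralE mu f0) (ge0_integralE mu g0).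
apply: le_ereal_sup => _ [h hf <-]; exists h => // x.
apply: le_trans (hf x) _; rewrite !patchE; case: ifPn => // /set_mem; exact: fg.
Qed.

Lemma measurable_fun_powR_comp {d} {T : measurableType d} {R : realType} (p : R) (f : T -> R) :
  measurable_fun [set: T] f -> measurable_fun [set: T] (fun y => f y `^ p).
Proof. by move=> mf; apply: (@measurableT_comp _ _ _ _ _ _ (@powR R ^~ p)). Qed.

Section change_of_variables.
Context {R : realType}.
Local Notation mu := (@lebesgue_measure R).
Local Open Scope ereal_scope.

Lemma ge0_integral_affine (a b : R) (h : R -> \bar R) : (0 < a)%R ->
  measurable_fun [set: R] h -> (forall x, 0 <= h x) ->
  \int[mu]_x h x = a%:E * \int[mu]_x h (a * x + b)%R.
Proof.
move=> a0 mh h0.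
pose phi (x : measurableTypeR R) : measurableTypeR R := (a * x + b)%R.
have mphi : measurable_fun setT phi.
  by apply: measurable_funD => //; exact: measurable_funM.
pose push : {measure set (measurableTypeR R) -> \bar R} :=
  measure_function_pushforward__canonical__measure_function_Measure mu mphi.
pose nu' := mscale (NngNum (ltW a0)) push.
(* Lebesgue measure is determined by its values on half-open intervals, so it equals [a] times its
   pushforward under x -> a x + b. *)
rewrite (@eq_measure_integral _ _ _ _ nu' mu) /=; last first.
  move=> A mA _; apply: lebesgue_measure_unique => //= _ [[c d]] _ <-.
  rewrite -[RHS]/(a%:E * mu (phi @^-1` `]c, d]%classic)).
  rewrite (_ : phi @^-1` `]c, d]%classic = `]((c - b) / a)%R, ((d - b) / a)%R]%classic); last
    first.
    apply/seteqP; split => x /=; rewrite !in_itv /= /phi /= => /andP[].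
      by rewrite ltr_pdivrMr// ler_pdivlMr// => h1 h2; rewrite ltrBlDr lerBrDr mulrC h1.
    by rewrite ltr_pdivrMr// ler_pdivlMr// => h1 h2; rewrite -ltrBlDr -lerBrDr mulrC h1.
  rewrite !lebesgue_measure_itv/= !lte_fin ltr_pM2r ?invr_gt0// ltrD2r.
  case: ifPn => cd; last by rewrite mule0.
  by rewrite -!EFinB -EFinM -mulrBl mulrC divfK ?gt_eqF//; congr EFin; ring.
rewrite ge0_integral_mscale//= ge0_integral_pushforward//=.
Qed.

Lemma ge0_integral_opp (h : R -> \bar R) :
  measurable_fun [set: R] h -> (forall x, 0 <= h x) ->
  \int[mu]_x h x = \int[mu]_x h (- x)%R.
Proof.
move=> mh h0.
have mN : measurable_fun [set: measurableTypeR R] (-%R : _ -> measurableTypeR R).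
  exact: oppr_measurable.
pose push : {measure set (measurableTypeR R) -> \bar R} :=
  measure_function_pushforward__canonical__measure_function_Measure mu mN.
rewrite (@eq_measure_integral _ _ _ _ push mu); last first.
  by move=> A mA _; exact/esym/lebesgue_measureN.
by rewrite ge0_integral_pushforward.
Qed.

End change_of_variables.

Section power_integrals.
Context {R : realType}.
Local Notation mu := (@lebesgue_measure R).
Local Open Scope ereal_scope.

Lemma is_derive_powR (s x : R) : (0 < x)%R ->
  is_derive x 1%R (fun y : R => y `^ s)%R (s * x `^ (s - 1))%R.
Proof.
move=> x0; have xi : x \in `]0%R, +oo[ by rewrite in_itv/= x0.
by apply: DeriveDef; [exact: derivable_powR|rewrite -derive1E powR_derive1].
Qed.

Lemma continuous_powR (s x : R) : (0 < x)%R -> {for x, continuous (fun y : R => y `^ s)%R}.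
Proof.
move=> x0; apply: differentiable_continuous; apply/derivable1_diffP.
by have [] := is_derive_powR s _ x0.
Qed.

Lemma integral_powR_cc (s a b : R) : (0 < a < b)%R -> s != 1%R ->
  \int[mu]_(x in `[a, b]) (x `^ (- s))%:E =
  ((b `^ (1 - s) - a `^ (1 - s)) / (1 - s))%:E.
Proof.
move=> /andP[a0 ab] s1; have s10 : (1 - s != 0)%R by rewrite subr_eq0 eq_sym.
have D (x : R) : (0 < x)%R -> is_derive x 1%R (fun y : R => y `^ (1 - s) / (1 - s))%R (x `^
  (- s))%R.
  move=> x0; have := is_deriveM (is_derive_powR (1 - s) x x0) (is_derive_cst ((1 - s)^-1)%R x
    1%R).
  move=> H; apply: (is_derive_eq H).
  by rewrite /= scaler0 add0r /GRing.scale/= mulrA mulVf// mul1r; congr (_ `^ _)%R; ring.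
rewrite (@continuous_FTC2 _ _ (fun y => y `^ (1 - s) / (1 - s))%R)//.
- by rewrite -EFinB -mulrBl.
- apply: continuous_in_subspaceT => x; rewrite inE/= in_itv/= => /andP[ax _].
  by apply: continuous_powR; exact: lt_le_trans ax.
- have dc (x : R) : (0 < x)%R -> {for x, continuous (fun y : R => y `^ (1 - s) / (1 - s))%R}.
    move=> x0; apply: differentiable_continuous; apply/derivable1_diffP.
    by have [] := D _ x0.
  split.
  + by move=> x; rewrite in_itv/= => /andP[ax _]; have [] := D _ (lt_trans a0 ax).
  + by apply: cvg_at_right_filter; exact: dc.
  + by apply: cvg_at_left_filter; apply: dc; exact: lt_trans ab.
- move=> x; rewrite in_itv/= => /andP[ax _].
  by rewrite derive1E; have [_ ->] := D _ (lt_trans a0 ax).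
Qed.

Let ge0_integral_bigcup_le (F : nat -> set R) (f : R -> R) (M : \bar R) :
  nondecreasing_seq F -> (forall i, measurable (F i)) ->
  measurable_fun [set: R] f -> (forall x, 0 <= f x)%R ->
  (forall n, \int[mu]_(x in F n) (f x)%:E <= M) ->
  \int[mu]_(x in \bigcup_n F n) (f x)%:E <= M.
Proof.
move=> ndF mF mf f0 FM.
have H : \int[mu]_(x in F i) (f x)%:E @[i --> \oo] --> \int[mu]_(x in \bigcup_i F i) (f x)%:E.
  apply: ge0_nondecreasing_set_cvg_integral => //.
  - by move=> i; apply/measurable_EFinP; exact: measurable_funS mf.
  - by move=> i x _; rewrite lee_fin.
rewrite -(cvg_lim _ H)//; apply: lime_le; first by apply/cvg_ex; eexists; exact: H.
exact: nearW.
Qed.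

Lemma integral_powR_near0 (s c : R) : (0 < c)%R -> (s < 1)%R ->
  \int[mu]_(x in `]0%R, c]) (x `^ (- s))%:E <= (c `^ (1 - s) / (1 - s))%:E.
Proof.
move=> c0 s1; have s10 : (0 < 1 - s)%R by rewrite subr_gt0.
(* n+2 rather than n+1 keeps the left endpoint strictly below c, as [integral_powR_cc] demands. *)
have -> : `]0%R, c]%classic = \bigcup_n `[(c / n.+2%:R)%R, c]%classic.
  apply/seteqP; split => x /=.
    rewrite in_itv/= => /andP[x0 xc].
    have [n cxn] : exists n : nat, (c / x < n.+2%:R)%R.
      exists (Num.truncn (c / x)).
      apply: (lt_trans (truncnS_gt _)).
      by rewrite ltr_nat.
    exists n => //=; rewrite in_itv/= xc andbT ler_pdivrMr//.
    by rewrite mulrC -ler_pdivrMr// ltW.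
  by move=> [n _]/=; rewrite !in_itv/= => /andP[h ->]; rewrite andbT (lt_le_trans _ h)//
    divr_gt0.
apply: ge0_integral_bigcup_le.
- apply/nondecreasing_seqP => n; rewrite subsetEset; apply: subset_itvr; rewrite bnd_simp.
  by rewrite ler_pM2l// lef_pV2 ?posrE// ler_nat.
- by move=> n; exact: measurable_itv.
- exact: measurable_powR.
- by move=> x; exact: powR_ge0.
- move=> n; rewrite integral_powR_cc ?lt_eqF//; last first.
    by rewrite divr_gt0//= ltr_pdivrMr// ltr_pMr// ltr1n.
  by rewrite lee_fin ler_pM2r ?invr_gt0// lerBlDr lerDl powR_ge0.
Qed.

Lemma integral_powR_nearoo (s c : R) : (0 < c)%R -> (1 < s)%R ->
  \int[mu]_(x in `[c, +oo[) (x `^ (- s))%:E <= (c `^ (1 - s) / (s - 1))%:E.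
Proof.
move=> c0 s1; have s10 : (0 < s - 1)%R by rewrite subr_gt0.
have -> : `[c, +oo[%classic = \bigcup_n `[c, (c + n.+1%:R)%R]%classic.
  apply/seteqP; split => x /=.
    rewrite in_itv/= andbT => cx; exists (Num.truncn (x - c)) => //=.
    by rewrite in_itv/= cx -lerBlDl ltW// truncnS_gt.
  by move=> [n _]/=; rewrite !in_itv/= andbT => /andP[].
apply: ge0_integral_bigcup_le.
- apply/nondecreasing_seqP => n; rewrite subsetEset; apply: subset_itvl; rewrite bnd_simp.
  by rewrite lerD2l ler_nat.
- by move=> n; exact: measurable_itv.
- exact: measurable_powR.
- by move=> x; exact: powR_ge0.
- move=> n; rewrite integral_powR_cc ?gt_eqF//; last first.
    by rewrite c0/= ltrDl.
  rewrite lee_fin -[X in (_ / X)%R]opprB invrN mulrN -mulNr opprB ler_pM2r ?invr_gt0//.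
  by rewrite lerBlDr lerDl powR_ge0.
Qed.

End power_integrals.

(** * Hölder's inequality *)

Section hoelder_ereal.
Context {R : realType}.
Local Open Scope ereal_scope.

Lemma lee_poweR (r : R) (x y : \bar R) : (0 <= r)%R -> 0 <= x -> x <= y -> x `^ r <= y `^ r.
Proof.
move=> r0 x0 xy; apply: gt0_ler_poweR; rewrite ?in_itv//= ?leey ?andbT//.
exact: le_trans xy.
Qed.

(** Weighted AM-GM for x/a and y/b. The parameters a and b will be the integrals of F and G, which
    turns the pointwise bound into Hölder's inequality. *)
Lemma young_powR (t x y a b : R) : (0 < t < 1)%R -> (0 <= x)%R -> (0 <= y)%R ->
  (0 < a)%R -> (0 < b)%R ->
  (x `^ t * y `^ (1 - t) <= a `^ t * b `^ (1 - t) * (t / a * x + (1 - t) / b * y))%R.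
Proof.
move=> /andP[t0 t1] x0 y0 a0 b0; have t10 : (0 < 1 - t)%R by rewrite subr_gt0.
have xa : (0 <= x / a)%R by rewrite divr_ge0// ltW.
have yb : (0 <= y / b)%R by rewrite divr_ge0// ltW.
have := @conjugate_powR R ((x / a) `^ t)%R ((y / b) `^ (1 - t))%R t^-1%R (1 - t)^-1%R
  (powR_ge0 _ _) (powR_ge0 _ _).
rewrite !invr_gt0 !invrK => /(_ t0 t10); rewrite addrC subrK => /(_ erefl).
rewrite -!powRrM !mulfV ?gt_eqF// !powRr1// => H.
have -> : (x `^ t * y `^ (1 - t) =
           a `^ t * b `^ (1 - t) * ((x / a) `^ t * (y / b) `^ (1 - t)))%R.
  rewrite mulrACA -!powRM ?(ltW a0) ?(ltW b0)//.
  by rewrite ![(_ * (_ / _))%R]mulrC !divfK ?lt0r_neq0.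
rewrite ler_pM2l ?mulr_gt0 ?powR_gt0//.
by apply: le_trans H _; rewrite le_eqVlt; apply/orP; left; apply/eqP; ring.
Qed.

Lemma young_poweR (t a b : R) (x y : \bar R) : (0 < t < 1)%R -> 0 <= x -> 0 <= y ->
  (0 < a)%R -> (0 < b)%R ->
  x `^ t * y `^ (1 - t) <=
    (a `^ t * b `^ (1 - t))%:E * ((t / a)%:E * x + ((1 - t) / b)%:E * y).
Proof.
move=> t01 x0 y0 a0 b0; have /andP[t0 t1] := t01.
have t10 : (0 < 1 - t)%R by rewrite subr_gt0.
have ta : (0 < t / a)%R by rewrite divr_gt0.
have tb : (0 < (1 - t) / b)%R by rewrite divr_gt0.
have ab : (0 < a `^ t * b `^ (1 - t))%R by rewrite mulr_gt0 ?powR_gt0.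
have hy z : 0 <= z -> 0 <= ((1 - t) / b)%:E * z by move=> z0; rewrite mule_ge0// lee_fin ltW.
have hx z : 0 <= z -> 0 <= (t / a)%:E * z by move=> z0; rewrite mule_ge0// lee_fin ltW.
case: x x0 => [x| |] x0 //.
- case: y y0 => [y| |] y0 //.
  + by rewrite !poweR_EFin -!EFinM lee_fin; apply: young_powR.
  + rewrite [X in _ <= _ * (_ + X)]gt0_muley ?lte_fin// addey; last by rewrite -EFinM.
    by rewrite gt0_muley ?lte_fin// leey.
- rewrite [X in _ <= _ * (X + _)]gt0_muley ?lte_fin// addye; last first.
    by have := hy _ y0; case: (_ * _).
  by rewrite gt0_muley ?lte_fin// leey.
Qed.

Context d (T : measurableType d) (mu : {measure set T -> \bar R}).

Lemma measurable_fun_poweR (s : R) (H : T -> \bar R) :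
  measurable_fun [set: T] H -> measurable_fun [set: T] (fun x => H x `^ s).
Proof.
move=> mH; apply: (@measurableT_comp _ _ _ _ _ _ (@poweR R ^~ s)) => //.
exact: measurable_poweR.
Qed.

(** Integrate Young's inequality normalised by the two integrals: the bracket then integrates to t +
    (1 - t) = 1. Values in [0, +oo] are allowed because F and G will be powers of [Upos], not yet
    known to be finite. *)
Lemma ge0_hoelder_interp (t : R) (F G : T -> \bar R) : (0 < t < 1)%R ->
  measurable_fun [set: T] F -> measurable_fun [set: T] G ->
  (forall x, 0 <= F x) -> (forall x, 0 <= G x) ->
  \int[mu]_x (F x `^ t * G x `^ (1 - t)) <=
  (\int[mu]_x F x) `^ t * (\int[mu]_x G x) `^ (1 - t).
Proof.
move=> t01 mF mG F0 G0; have /andP[t0 t1] := t01.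
have t10 : (0 < 1 - t)%R by rewrite subr_gt0.
have mFG : measurable_fun [set: T] (fun x => F x `^ t * G x `^ (1 - t)).
  by apply: emeasurable_funM; exact: measurable_fun_poweR.
have iF : 0 <= \int[mu]_x F x by exact: integral_ge0.
have iG : 0 <= \int[mu]_x G x by exact: integral_ge0.
(* A zero integral makes the right side 0 even when the other integral is infinite, so the left
   integrand must then vanish almost everywhere. *)
have zero H s : (0 < s)%R -> measurable_fun [set: T] H -> (forall x, 0 <= H x) -> \int[mu]_x
  H x = 0 ->
    {ae mu, forall x, [set: T] x -> H x `^ s = 0}.
  move=> s0 mH H0 iH.
  have : {ae mu, forall x, [set: T] x -> H x = 0}.
    apply/(@ae_eq_integral_abs _ _ _ mu _ measurableT H mH).
    by rewrite -iH; apply: eq_integral => x _; rewrite gee0_abs.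
  by apply: filterS => x /(_ I) ->; rewrite poweR0r ?gt_eqF.
have zint : {ae mu, forall x, [set: T] x -> F x `^ t * G x `^ (1 - t) = 0} ->
    \int[mu]_x (F x `^ t * G x `^ (1 - t)) = 0.
  move=> /(ae_eq_integral_abs _ measurableT mFG).
  by under eq_integral do rewrite gee0_abs ?mule_ge0 ?poweR_ge0//.
have [A0|A0] := eqVneq (\int[mu]_x F x) 0.
  rewrite zint ?mule_ge0 ?poweR_ge0//.
  by apply: filterS (zero F t t0 mF F0 A0) => x /[apply] ->; rewrite mul0e.
have [B0|B0] := eqVneq (\int[mu]_x G x) 0.
  rewrite zint ?mule_ge0 ?poweR_ge0//.
  by apply: filterS (zero G (1 - t)%R t10 mG G0 B0) => x /[apply] ->; rewrite mule0.
have {}A0 : 0 < \int[mu]_x F x by rewrite lt0e A0.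
have {}B0 : 0 < \int[mu]_x G x by rewrite lt0e B0.
have [Ay|Ay] := eqVneq (\int[mu]_x F x) +oo.
  by rewrite Ay poweRyr ?gt_eqF// gt0_mulye ?leey// poweR_gt0.
have [By|By] := eqVneq (\int[mu]_x G x) +oo.
  by rewrite By poweRyr ?gt_eqF// gt0_muley ?leey// poweR_gt0.
have [a aE] : exists a, \int[mu]_x F x = a%:E.
  by exists (fine (\int[mu]_x F x)); rewrite fineK// ge0_fin_numE// lt_neqAle Ay leey.
have [b bE] : exists b, \int[mu]_x G x = b%:E.
  by exists (fine (\int[mu]_x G x)); rewrite fineK// ge0_fin_numE// lt_neqAle By leey.
move: A0 B0; rewrite aE bE !lte_fin => a0 b0.
have ta : (0 <= t / a)%R by rewrite divr_ge0// ltW.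
have tb : (0 <= (1 - t) / b)%R by rewrite divr_ge0// ltW.
have abt : (0 <= a `^ t * b `^ (1 - t))%R by rewrite mulr_ge0 ?powR_ge0.
apply: (@le_trans _ _ (\int[mu]_x ((a `^ t * b `^ (1 - t))%:E * ((t / a)%:E * F x + ((1 - t)
  / b)%:E * G x)))).
  apply: ge0_le_integral_nonmeas => x _; first by rewrite mule_ge0 ?poweR_ge0.
  exact: young_poweR.
rewrite ge0_integralZl_EFin//; last 2 first.
- by move=> x _; rewrite adde_ge0// mule_ge0// lee_fin.
- by apply: emeasurable_funD; exact: measurable_funeM.
rewrite ge0_integralD//; last 4 first.
- by move=> x _; rewrite mule_ge0// lee_fin.
- exact: measurable_funeM.
- by move=> x _; rewrite mule_ge0// lee_fin.
- exact: measurable_funeM.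
rewrite !ge0_integralZl_EFin// aE bE !poweR_EFin -!EFinM lee_fin.
by rewrite !divfK ?gt_eqF// (addrC t) subrK mulr1.
Qed.

Lemma ge0_hoelder3 (a b c : R) (F G H : T -> \bar R) :
  (0 < a)%R -> (0 < b)%R -> (0 < c)%R -> (a + b + c = 1)%R ->
  measurable_fun [set: T] F -> measurable_fun [set: T] G -> measurable_fun [set: T] H ->
  (forall x, 0 <= F x) -> (forall x, 0 <= G x) -> (forall x, 0 <= H x) ->
  \int[mu]_x (F x `^ a * (G x `^ b * H x `^ c)) <=
  (\int[mu]_x F x) `^ a * ((\int[mu]_x G x) `^ b * (\int[mu]_x H x) `^ c).
Proof.
move=> a0 b0 c0 abc mF mG mH F0 G0 H0.
have a1 : (0 < 1 - a)%R by lra.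
have bE : (b = b / (1 - a) * (1 - a))%R by rewrite divfK// gt_eqF.
have cE : (c = (1 - b / (1 - a)) * (1 - a))%R.
  by rewrite mulrBl divfK ?gt_eqF// mul1r -abc; ring.
(* The last two factors are grouped: Hölder is used with weights a and 1 - a, then with b / (1 - a)
   inside the group. *)
have split x y : 0 <= x -> 0 <= y ->
    x `^ b * y `^ c = (x `^ (b / (1 - a)) * y `^ (1 - b / (1 - a))) `^ (1 - a).
  by move=> x0 y0; rewrite poweRM ?poweR_ge0// -!poweRrM -bE -cE.
rewrite split ?integral_ge0//.
under eq_integral do rewrite split//.
apply: (le_trans (ge0_hoelder_interp _ _ _ _ _ _ _ _)) => //.
- by rewrite a0/= -subr_gt0.
- by apply: emeasurable_funM; exact: measurable_fun_poweR.
- by move=> x; rewrite mule_ge0 ?poweR_ge0.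
apply: lee_wpmul2l; first exact: poweR_ge0.
apply: lee_poweR; first exact: ltW.
  by apply: integral_ge0 => x _; rewrite mule_ge0 ?poweR_ge0.
apply: ge0_hoelder_interp => //.
by rewrite divr_gt0//= ltr_pdivrMr// mul1r; lra.
Qed.

End hoelder_ereal.

(** * Estimates of the kernel operator *)

Section beta_integrals.
Context {R : realType}.
Local Notation mu := (@lebesgue_measure R).
Local Open Scope ereal_scope.

(** Set to zero outside (0, c], so that the singularities at both ends of the beta integrals become
    translates or reflections of one function integrated over the whole line. *)
Let pw (c s u : R) : R := (if (0 < u) && (u <= c) then u `^ (- s) else 0)%R.

Let pw_ge0 c s u : (0 <= pw c s u)%R.
Proof. by rewrite /pw; case: ifP => // _; exact: powR_ge0. Qed.

Let measurable_pw c s : measurable_fun [set: R] (pw c s).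
Proof.
apply: measurable_fun_ifT => //.
by apply: measurable_and; [exact: measurable_fun_ltr|exact: measurable_fun_ler].
Qed.

Let integral_pw c s : (0 < c)%R -> (s < 1)%R ->
  \int[mu]_u (pw c s u)%:E <= (c `^ (1 - s) / (1 - s))%:E.
Proof.
move=> c0 s1; apply: (le_trans _ (integral_powR_near0 s c c0 s1)).
rewrite [leRHS]integral_mkcond; apply: ge0_le_integral_nonmeas => x _.
  by rewrite lee_fin.
by rewrite patchE /pw mem_setE in_itv/=; case: ifP.
Qed.

Let integral_pwB c s x : (0 < c)%R -> (s < 1)%R ->
  \int[mu]_y (pw c s (y - x)%R)%:E <= (c `^ (1 - s) / (1 - s))%:E.
Proof.
move=> c0 s1; apply: (le_trans _ (integral_pw c s c0 s1)).
rewrite (@ge0_integral_affine _ 1%R (- x)%R (fun u => (pw c s u)%:E)) ?ltr01//.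
- by rewrite mul1e; apply: ge0_le_integral_nonmeas => y _; rewrite ?lee_fin ?mul1r.
- exact/measurable_EFinP.
- by move=> u; rewrite lee_fin.
Qed.

Let integral_pwBC c s x : (0 < c)%R -> (s < 1)%R ->
  \int[mu]_y (pw c s (x - y)%R)%:E <= (c `^ (1 - s) / (1 - s))%:E.
Proof.
move=> c0 s1; apply: (le_trans _ (integral_pwB c s (- x)%R c0 s1)).
rewrite (@ge0_integral_opp _ (fun y => (pw c s (x - y)%R)%:E)).
- by apply: ge0_le_integral_nonmeas => y _; rewrite ?lee_fin// !opprK addrC.
- apply/measurable_EFinP; apply: (measurableT_comp (measurable_pw c s)).
  by apply: measurable_funB.
- by move=> u; rewrite lee_fin.
Qed.

Let measurable_pwB c s x : measurable_fun [set: R] (fun y => pw c s (x - y)%R).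
Proof. by apply: (measurableT_comp (measurable_pw _ _)); exact: measurable_funB. Qed.

Let measurable_pwBl c s x : measurable_fun [set: R] (fun y => pw c s (y - x)%R).
Proof. by apply: (measurableT_comp (measurable_pw _ _)); exact: measurable_funB. Qed.

Let ge0_integral_lin2 (c1 c2 : R) (f g : R -> R) : (0 <= c1)%R -> (0 <= c2)%R ->
  measurable_fun [set: R] f -> measurable_fun [set: R] g ->
  (forall x, 0 <= f x)%R -> (forall x, 0 <= g x)%R ->
  \int[mu]_y (c1%:E * (f y)%:E + c2%:E * (g y)%:E) =
  c1%:E * \int[mu]_y (f y)%:E + c2%:E * \int[mu]_y (g y)%:E.
Proof.
move=> c10 c20 mf mg f0 g0.
have mf' : measurable_fun [set: R] (EFin \o f) by exact/measurable_EFinP.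
have mg' : measurable_fun [set: R] (EFin \o g) by exact/measurable_EFinP.
rewrite -!ge0_integralZl_EFin//=; try by move=> *; rewrite lee_fin.
rewrite -ge0_integralD//; try by move=> *; rewrite -EFinM lee_fin mulr_ge0.
- exact: measurable_funeM.
- exact: measurable_funeM.
Qed.

(** Cut at x/2: on each half, the factor that is regular there is at most its value at x/2, and the
    singular one is integrated as a pure power. *)
Lemma integral_beta_le (a t : R) : (0 <= a < 1)%R -> (0 <= t < 1)%R ->
  exists2 C : R, (0 < C)%R & forall x : R, (0 < x)%R ->
  \int[mu]_y ((if (0 < y) && (y < x) then y `^ (- a) * (x - y) `^ (- t) else 0)%R)%:E
    <= (C * x `^ (1 - a - t))%:E.
Proof.
move=> /andP[a0 a1] /andP[t0 t1].
have a10 : (0 < 1 - a)%R by rewrite subr_gt0.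
have t10 : (0 < 1 - t)%R by rewrite subr_gt0.
exists (2 `^ t / (1 - a) + 2 `^ a / (1 - t))%R.
  by rewrite addr_gt0// divr_gt0// powR_gt0.
move=> x x0; have x20 : (0 < x / 2)%R by rewrite divr_gt0.
have half s : ((x / 2) `^ (- s) = 2 `^ s * x `^ (- s))%R.
  rewrite mulrC powRM ?invr_ge0 ?(ltW x0)//; congr (_ * _)%R.
  by rewrite -(powR_inv1 (@ltW _ _ 0%R 2%R (ltr0n _ 2)))// -powRrM mulN1r opprK.
have antimono s u v : (0 <= s)%R -> (0 < u)%R -> (u <= v)%R -> (v `^ (- s) <= u `^ (- s))%R.
  move=> s0 u0 uv; rewrite !powRN lef_pV2 ?posrE ?powR_gt0//; last exact: lt_le_trans uv.
  by apply: ge0_ler_powR; rewrite ?nnegrE// ltW//; exact: lt_le_trans uv.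
apply: (@le_trans _ _ (\int[mu]_y ((2 `^ t * x `^ (- t))%:E * (pw x a y)%:E + (2 `^ a * x `^
  (- a))%:E * (pw x t (x - y)%R)%:E))).
  apply: ge0_le_integral_nonmeas => y _.
    by rewrite lee_fin; case: ifP => // _; rewrite mulr_ge0 ?powR_ge0.
  rewrite -!EFinM -EFinD lee_fin -!half; case: ifPn => [/andP[y0 yx]|_]; last first.
    by rewrite addr_ge0// mulr_ge0 ?powR_ge0.
  rewrite /pw y0 (ltW yx) subr_gt0 yx gerBl (ltW y0)/=.
  have [h|h] := leP y (x / 2)%R.
    apply: (@le_trans _ _ ((x / 2) `^ (- t) * y `^ (- a))%R).
      rewrite mulrC ler_wpM2r ?powR_ge0//; apply: antimono => //.
      lra.
    by rewrite lerDl mulr_ge0 ?powR_ge0.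
  apply: (@le_trans _ _ ((x / 2) `^ (- a) * (x - y) `^ (- t))%R).
    by rewrite ler_wpM2r ?powR_ge0//; apply: antimono => //; exact: ltW.
  by rewrite lerDr mulr_ge0 ?powR_ge0.
rewrite ge0_integral_lin2 ?mulr_ge0 ?powR_ge0//.
apply: (@le_trans _ _ ((2 `^ t * x `^ (- t))%:E * (x `^ (1 - a) / (1 - a))%:E + (2 `^ a * x
  `^ (- a))%:E * (x `^ (1 - t) / (1 - t))%:E)).
  by apply: leeD; apply: lee_wpmul2l; rewrite ?lee_fin ?mulr_ge0 ?powR_ge0 ?integral_pw
    ?integral_pwBC.
rewrite -!EFinM -EFinD lee_fin.
have E1 : (x `^ (- t) * x `^ (1 - a) = x `^ (1 - a - t))%R.
  by rewrite -powRD ?(gt_eqF x0) ?implybT//; congr (_ `^ _)%R; ring.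
have E2 : (x `^ (- a) * x `^ (1 - t) = x `^ (1 - a - t))%R.
  by rewrite -powRD ?(gt_eqF x0) ?implybT//; congr (_ `^ _)%R; ring.
rewrite mulrDl le_eqVlt; apply/orP; left; apply/eqP; congr (_ + _)%R.
  by rewrite -E1; ring.
by rewrite -E2; ring.
Qed.

(** Cut at x = 2 y. Up to there x^(-a) is at most y^(-a) and only the singularity at y counts;
    beyond it x - y is at least x/2, which leaves the tail of x^(-(a + t)), convergent because a + t
    > 1. *)
Lemma integral_beta_oo_le (a t : R) : (0 <= a)%R -> (0 <= t < 1)%R -> (1 < a + t)%R ->
  exists2 C : R, (0 < C)%R & forall y : R, (0 < y)%R ->
  \int[mu]_x ((if y < x then x `^ (- a) * (x - y) `^ (- t) else 0)%R)%:E
    <= (C * y `^ (1 - a - t))%:E.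
Proof.
move=> a0 /andP[t0 t1] at1.
have t10 : (0 < 1 - t)%R by rewrite subr_gt0.
have at10 : (0 < a + t - 1)%R by rewrite subr_gt0.
exists (1 / (1 - t) + 2 `^ t / (a + t - 1))%R.
  by rewrite addr_gt0// divr_gt0// powR_gt0.
move=> y y0.
have half s x : (0 < x)%R -> ((x / 2) `^ (- s) = 2 `^ s * x `^ (- s))%R.
  move=> x0; rewrite mulrC powRM ?invr_ge0 ?(ltW x0)//; congr (_ * _)%R.
  by rewrite -(powR_inv1 (@ltW _ _ 0%R 2%R (ltr0n _ 2)))// -powRrM mulN1r opprK.
have antimono s u v : (0 <= s)%R -> (0 < u)%R -> (u <= v)%R -> (v `^ (- s) <= u `^ (- s))%R.
  move=> s0 u0 uv; rewrite !powRN lef_pV2 ?posrE ?powR_gt0//; last exact: lt_le_trans uv.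
  by apply: ge0_ler_powR; rewrite ?nnegrE// ltW//; exact: lt_le_trans uv.
have mtail : measurable_fun [set: R] (((fun x : R => x `^ (- (a + t)))%R \_ `[y, +oo[) : R ->
  R).
  by apply/(measurable_restrictT _ _).1 => //; apply: measurable_funTS; exact: measurable_powR.
pose tail := ((fun x : R => x `^ (- (a + t)))%R \_ `[y, +oo[) : R -> R.
have tail0 x : (0 <= tail x)%R.
  by rewrite /tail patchE; case: ifPn => // _; exact: powR_ge0.
apply: (@le_trans _ _ (\int[mu]_x ((y `^ (- a))%:E * (pw y t (x - y)%R)%:E + (2 `^ t)%:E *
  (tail x)%:E))).
  apply: ge0_le_integral_nonmeas => x _.
    by rewrite lee_fin; case: ifP => // _; rewrite mulr_ge0 ?powR_ge0.
  rewrite -!EFinM -EFinD lee_fin; case: ifPn => [yx|_]; last first.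
    by rewrite addr_ge0// mulr_ge0 ?powR_ge0.
  have x0 : (0 < x)%R by exact: lt_trans yx.
  rewrite /pw /tail patchE subr_gt0 yx/= mem_set/=; last by rewrite in_itv/= ltW.
  have [h|h] := leP (x - y)%R y.
    apply: (@le_trans _ _ (y `^ (- a) * (x - y) `^ (- t))%R).
      by rewrite ler_wpM2r ?powR_ge0//; apply: antimono => //; exact: ltW.
    by rewrite lerDl mulr_ge0 ?powR_ge0.
  rewrite mulr0 add0r.
  rewrite (_ : - (a + t) = - a + - t)%R; last by ring.
  rewrite powRD ?(gt_eqF x0) ?implybT// mulrCA ler_wpM2l ?powR_ge0//.
  rewrite -half//; apply: antimono; rewrite ?divr_gt0//; lra.
rewrite ge0_integral_lin2 ?powR_ge0//.
apply: (@le_trans _ _ ((y `^ (- a))%:E * (y `^ (1 - t) / (1 - t))%:E + (2 `^ t)%:E * (y `^ (1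
  - (a + t)) / (a + t - 1))%:E)).
  apply: leeD; apply: lee_wpmul2l; rewrite ?lee_fin ?powR_ge0//.
    exact: integral_pwB.
  apply: (le_trans _ (integral_powR_nearoo (a + t)%R y y0 at1)).
  rewrite [leRHS]integral_mkcond; apply: ge0_le_integral_nonmeas => x _.
    by rewrite lee_fin.
  by rewrite /tail !patchE; case: ifP.
rewrite -!EFinM -EFinD lee_fin.
have E1 : (y `^ (- a) * y `^ (1 - t) = y `^ (1 - a - t))%R.
  by rewrite -powRD ?(gt_eqF y0) ?implybT//; congr (_ `^ _)%R; ring.
rewrite (_ : 1 - (a + t) = 1 - a - t)%R; last by ring.
rewrite mulrA E1 le_eqVlt; apply/orP; left; apply/eqP; ring.
Qed.

End beta_integrals.

(** Vanishing off 0 < y < x lets every integral run over the whole line; there x - y is positive, so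
    the absolute value of [Uop] disappears. *)
Definition Ukern {R : realType} (al be la x y : R) : R :=
  if (0 < y) && (y < x) then x `^ (- be) * (y `^ (- al) * (x - y) `^ (- la)) else 0.

Definition Upos {R : realType} (al be la : R) (g : R -> R) (x : R) : \bar R :=
  (\int[lebesgue_measure]_y (Ukern al be la x y * g y)%:E)%E.

(** * A weighted Young inequality for the homogeneous kernel *)

Section young.
Context {R : realType}.
Variables al be la : R.
Local Notation mu := (@lebesgue_measure R).
Local Notation kern := (Ukern al be la).
Local Notation Tpos := (Upos al be la).
Local Open Scope ereal_scope.

Lemma kern_ge0 x y : (0 <= kern x y)%R.
Proof. by rewrite /kern; case: ifP => // _; rewrite !mulr_ge0 ?powR_ge0. Qed.

Lemma kern_gt0 x y : (0 < y < x)%R -> (0 < kern x y)%R.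
Proof.
move=> yx; rewrite /kern yx; case/andP: yx => y0 yx.
by rewrite !mulr_gt0 ?powR_gt0 ?subr_gt0// (lt_trans y0).
Qed.

Lemma measurable_kern : measurable_fun [set: R * R] (fun z => kern z.1 z.2).
Proof.
have m1 : measurable_fun [set: R * R] (fun z : R * R => z.1) by exact: measurable_fst.
have m2 : measurable_fun [set: R * R] (fun z : R * R => z.2) by exact: measurable_snd.
apply: measurable_fun_ifT => //.
- by apply: measurable_and; apply: measurable_fun_ltr.
- apply: measurable_funM; first exact: measurable_fun_powR_comp.
  apply: measurable_funM; first exact: measurable_fun_powR_comp.
  by apply: (measurable_fun_powR_comp _ (fun z : R * R => z.1 - z.2)%R); exact: measurable_funB.
Qed.

Lemma measurable_kernl x : measurable_fun [set: R] (kern x).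
Proof.
rewrite (_ : kern x = (fun z => kern z.1 z.2) \o pair x)//.
exact: (measurableT_comp measurable_kern).
Qed.

Lemma Tpos_ge0 (g : R -> R) x : (forall y, 0 <= g y)%R -> 0 <= Tpos g x.
Proof. by move=> g0; apply: integral_ge0 => y _; rewrite lee_fin mulr_ge0// kern_ge0. Qed.

Lemma Tpos_le0 (g : R -> R) x : (x <= 0)%R -> Tpos g x = 0.
Proof.
move=> x0; apply: integral0_eq => y _; rewrite /kern.
by case: ifPn; rewrite ?mul0r// => /andP[y0 yx]; have := lt_le_trans (lt_trans y0 yx) x0;
  rewrite ltxx.
Qed.

Lemma measurable_Tpos (g : R -> R) : measurable_fun [set: R] g -> (forall y, 0 <= g y)%R ->
  measurable_fun [set: R] (Tpos g).
Proof.
move=> mg g0.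
apply: (@measurable_fun_fubini_tonelli_F _ _ _ _ _ mu (fun z : R * R => (kern z.1 z.2 * g
  z.2)%:E)).
- apply/measurable_EFinP; apply: measurable_funM; first exact: measurable_kern.
  by apply: (measurableT_comp mg); exact: measurable_snd.
- by move=> z; rewrite lee_fin mulr_ge0// kern_ge0.
Qed.

Hypotheses (al0 : (0 < al)%R) (be0 : (0 < be)%R) (la0 : (0 < la)%R).
Local Notation ka := (kappa al be la).

(* With r = 1/kappa, p = 1/u, q = 1/v and p' the conjugate exponent of p, Hölder's
   inequality is applied to the factorization
     k g = (k^r g^p y^(s q))^v * (g^p)^(1 - kappa) * (k^r y^(- s p'))^(1 - u).
   The two beta integrals that arise converge iff
     alpha v / kappa < s < (beta + lambda) (1 - u) / kappa,
   and such an [s] exists because u < 1 - alpha. *)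
Lemma Tpos_young (u : R) : (ka < 1)%R -> (1 - ka < u < 1 - al)%R ->
  exists2 C : R, (0 < C)%R & forall g : R -> R, measurable_fun [set: R] g ->
    (forall y, 0 <= g y)%R ->
    \int[mu]_x (Tpos g x `^ (u + ka - 1)^-1) <=
    C%:E * (\int[mu]_y (g y `^ u^-1)%:E) `^ (u / (u + ka - 1)).
Proof.
move=> ka1 /andP[ku ua].
move: (al0) (be0) (la0) => al0' be0' la0'.
have kaE : ka = (al + be + la)%R by [].
have ka0 : (0 < ka)%R by rewrite kaE !addr_gt0.
set v := (u + ka - 1)%R.
have v0 : (0 < v)%R by rewrite subr_gt0 -ltrBlDr.
have w0 : (0 < 1 - u)%R by rewrite subr_gt0 (lt_trans ua)// gtrBl.
have u0 : (0 < u)%R by apply: lt_trans ku; rewrite subr_gt0.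
have key : (al * v < (be + la) * (1 - u))%R.
  rewrite -subr_gt0 (_ : _ - _ = ka * (1 - al - u))%R; last by rewrite /v kaE; ring.
  by rewrite mulr_gt0//; lra.
have [s s1 s2] : exists2 s : R, (al * v / ka < s)%R & (s < (be + la) * (1 - u) / ka)%R.
  exists (((al * v) / ka + ((be + la) * (1 - u)) / ka) / 2)%R.
    by rewrite midf_lt// ltr_pM2r ?invr_gt0.
  by rewrite midf_lt// ltr_pM2r ?invr_gt0.
have s0 : (0 < s)%R by apply: lt_trans s1; rewrite divr_gt0// mulr_gt0.
have lt1 : (0 <= la / ka < 1)%R.
  by rewrite divr_ge0 ?(ltW la0) ?(ltW ka0)//= ltr_pdivrMr// mul1r kaE; lra.
have [C1 C10 HC1] : exists2 C : R, (0 < C)%R & forall x : R, (0 < x)%R ->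
    \int[mu]_y ((if (0 < y) && (y < x) then y `^ (- (al / ka + s / (1 - u))) * (x - y) `^ (-
      (la / ka)) else 0)%R)%:E
    <= (C * x `^ (1 - (al / ka + s / (1 - u)) - la / ka))%:E.
  apply: integral_beta_le => //; rewrite addr_ge0 ?divr_ge0 ?ltW//=.
  rewrite -ltrBrDl ltr_pdivrMr//; apply: (lt_le_trans s2).
  rewrite mulrAC ler_pM2r// kaE le_eqVlt; apply/orP; left; apply/eqP.
  by field; rewrite -kaE gt_eqF.
have [C2 C20 HC2] : exists2 C : R, (0 < C)%R & forall y : R, (0 < y)%R ->
    \int[mu]_x ((if y < x then x `^ (- (be / ka + s / v)) * (x - y) `^ (- (la / ka)) else
      0)%R)%:E
    <= (C * y `^ (1 - (be / ka + s / v) - la / ka))%:E.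
  apply: integral_beta_oo_le => //; rewrite ?addr_ge0 ?divr_ge0 ?ltW//=.
  have : (al / ka < s / v)%R by rewrite ltr_pdivlMr// mulrAC.
  suff -> : (1 = al / ka + be / ka + la / ka)%R by move: (al / ka)%R (be / ka)%R (la / ka)%R
    (s / v)%R => *; lra.
  by rewrite -!mulrDl -kaE divff// gt_eqF.
exists (C1 `^ ((1 - u) / v) * C2)%R; first by rewrite mulr_gt0 ?powR_gt0.
move=> g mg g0.
set N := \int[mu]_y (g y `^ u^-1)%:E.
have N0 : 0 <= N by apply: integral_ge0 => y _; rewrite lee_fin powR_ge0.
(* The power k^r is homogeneous of degree -1: the exponents al/ka, be/ka and la/ka sum to 1. The
   cancellations of powers of x and y below rest on this. *)
pose r := ka^-1%R.
pose F1 x y : \bar R := ((kern x y) `^ r * (g y `^ u^-1 * y `^ (s / v)))%:E.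
pose F2 y : \bar R := (g y `^ u^-1)%:E.
pose F3 x y : \bar R := ((kern x y) `^ r * y `^ (- (s / (1 - u))))%:E.
have mF1 x : measurable_fun [set: R] (F1 x).
  apply/measurable_EFinP; apply: measurable_funM; first by apply: measurable_fun_powR_comp;
    exact: measurable_kernl.
  by apply: measurable_funM; exact: measurable_fun_powR_comp.
have mF2 : measurable_fun [set: R] F2 by apply/measurable_EFinP; exact:
  measurable_fun_powR_comp.
have mF3 x : measurable_fun [set: R] (F3 x).
  apply/measurable_EFinP; apply: measurable_funM; first by apply: measurable_fun_powR_comp;
    exact: measurable_kernl.
  exact: measurable_fun_powR_comp.
have F10 x y : 0 <= F1 x y by rewrite lee_fin !mulr_ge0 ?powR_ge0.
have F20 y : 0 <= F2 y by rewrite lee_fin powR_ge0.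
have F30 x y : 0 <= F3 x y by rewrite lee_fin !mulr_ge0 ?powR_ge0.
have r0 : (0 < r)%R by rewrite invr_gt0.
have kr x y : (0 < y)%R -> (y < x)%R -> (kern x y `^ r =
    x `^ (- (be / ka)) * (y `^ (- (al / ka)) * (x - y) `^ (- (la / ka))))%R.
  move=> y0 yx; rewrite /Ukern y0 yx/= !powRM ?mulr_ge0 ?powR_ge0//.
  by rewrite -!powRrM -/r !mulNr.
have kr0 x y : ~~ ((0 < y)%R && (y < x)%R) -> (kern x y `^ r = 0)%R.
  by move=> /negbTE h; rewrite /Ukern h powR0// gt_eqF.
have pd (x a b : R) : (0 < x)%R -> (x `^ a * x `^ b = x `^ (a + b))%R.
  by move=> x0; rewrite powRD// (gt_eqF x0) implybT.
have Tle x : Tpos g x <= (\int[mu]_y F1 x y) `^ v * (N `^ (1 - ka) * (\int[mu]_y F3 x y) `^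
  (1 - u)).
  have kb : (0 < 1 - ka)%R by rewrite subr_gt0.
  have sum1 : (v + (1 - ka) + (1 - u) = 1)%R by rewrite /v; ring.
  apply: (le_trans _ (ge0_hoelder3 _ _ mu v (1 - ka) (1 - u) (F1 x) F2 (F3 x)
    v0 kb w0 sum1 (mF1 x) mF2 (mF3 x) (F10 x) F20 (F30 x))).
  apply: ge0_le_integral_nonmeas => y _.
    by rewrite lee_fin mulr_ge0// kern_ge0.
  have [/andP[y0 yx]|h] := boolP ((0 < y)%R && (y < x)%R); last first.
    by rewrite {1}/Ukern (negbTE h) mul0r !mule_ge0 ?poweR_ge0.
  rewrite /F1 /F2 /F3 !poweR_EFin -!EFinM lee_fin.
  rewrite !powRM ?mulr_ge0 ?powR_ge0//.
  rewrite -!powRrM le_eqVlt; apply/orP; left; apply/eqP.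
  have k0 : (0 < kern x y)%R by rewrite kern_gt0// y0.
  rewrite (_ : - (s / (1 - u)) * (1 - u) = - s)%R; last by rewrite mulNr divfK ?gt_eqF.
  rewrite (_ : s / v * v = s)%R; last by rewrite divfK ?gt_eqF.
  have [gy0|gy0] := eqVneq (g y) 0%R.
    by rewrite gy0 (@powR0 _ (u^-1 * v)%R) ?mul0r ?mulr0 ?mul0r ?mulr0// gt_eqF// mulr_gt0//
      invr_gt0.
  have gy : (0 < g y)%R by rewrite lt0r gy0 g0.
  transitivity ((kern x y `^ (r * v) * kern x y `^ (r * (1 - u))) *
    (g y `^ (u^-1 * v) * g y `^ (u^-1 * (1 - ka))) * (y `^ s * y `^ (- s)))%R; last by ring.
  rewrite !pd// addrN powRr0 mulr1.
  rewrite (_ : r * v + r * (1 - u) = 1)%R; last first.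
    rewrite -mulrDr (_ : v + (1 - u) = ka)%R; last by rewrite /v; ring.
    by rewrite mulVf ?gt_eqF.
  rewrite (_ : u^-1 * v + u^-1 * (1 - ka) = 1)%R; last first.
    rewrite -mulrDr (_ : v + (1 - ka) = u)%R; last by rewrite /v; ring.
    by rewrite mulVf ?gt_eqF.
  by rewrite !powRr1 ?ltW.
have F3le x : (0 < x)%R -> \int[mu]_y F3 x y <= (C1 * x `^ (- (s / (1 - u))))%:E.
  move=> x0.
  apply: (@le_trans _ _ (\int[mu]_y ((x `^ (- (be / ka)))%:E * ((if (0 < y) && (y < x) then y
    `^ (- (al / ka + s / (1 - u))) * (x - y) `^ (- (la / ka)) else 0)%R)%:E))).
    apply: ge0_le_integral_nonmeas => y _; first exact: F30.
    rewrite /F3 -EFinM lee_fin; case: ifPn => [/andP[y0 yx]|h]; last by rewrite kr0// mul0r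
      mulr0.
    rewrite kr// opprD -pd// le_eqVlt; apply/orP; left; apply/eqP; ring.
  rewrite ge0_integralZl//; last 3 first.
  - apply/measurable_EFinP; apply: measurable_fun_ifT => //.
      by apply: measurable_and; apply: measurable_fun_ltr.
    by apply: measurable_funM; [exact: measurable_fun_powR_comp|apply:
      measurable_fun_powR_comp; exact: measurable_funB].
  - by move=> y _; rewrite lee_fin; case: ifP => // _; rewrite mulr_ge0 ?powR_ge0.
  - by rewrite lee_fin powR_ge0.
  apply: (@le_trans _ _ ((x `^ (- (be / ka)))%:E * (C1 * x `^ (1 - (al / ka + s / (1 - u)) -
    la / ka))%:E)).
    by apply: lee_wpmul2l; [rewrite lee_fin powR_ge0|exact: HC1].
  rewrite -EFinM lee_fin mulrCA pd// (_ : _ + _ = - (s / (1 - u)))%R//.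
  have -> : (1 = al / ka + be / ka + la / ka)%R by rewrite -!mulrDl -kaE divff// gt_eqF.
  ring.
have v0' : (0 < v^-1)%R by rewrite invr_gt0.
(* Raised to the power (1 - u) / v, the bound on the integral of [F3] leaves the factor x^(-s/v). It
   is kept inside the integrand, so that Tonelli's theorem can let x be integrated first. *)
pose H (z : R * R) : \bar R :=
  (z.1 `^ (- (s / v)) * ((kern z.1 z.2) `^ r * (g z.2 `^ u^-1 * z.2 `^ (s / v))))%:E.
have HE x y : H (x, y) = (x `^ (- (s / v)))%:E * F1 x y by rewrite /F1 -EFinM.
have H0 z : 0 <= H z by rewrite lee_fin !mulr_ge0 ?powR_ge0.
have mH : measurable_fun [set: R * R] H.
  have m2 : measurable_fun [set: R * R] (fun z : R * R => z.2) by exact: measurable_snd.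
  apply/measurable_EFinP; apply: measurable_funM; first by apply: measurable_fun_powR_comp;
    exact: measurable_fst.
  apply: measurable_funM; first by apply: measurable_fun_powR_comp; exact: measurable_kern.
  by apply: measurable_funM; [apply: (measurable_fun_powR_comp _ (fun z : R * R => g z.2));
    exact: (measurableT_comp mg)|exact: measurable_fun_powR_comp].
have step x : Tpos g x `^ v^-1 <=
    (N `^ ((1 - ka) / v) * (C1 `^ ((1 - u) / v))%:E) * \int[mu]_y H (x, y).
  have [x0|x0] := leP x 0%R.
    rewrite Tpos_le0// poweR0r ?gt_eqF// mule_ge0 ?mule_ge0 ?poweR_ge0 ?lee_fin ?powR_ge0//.
    by apply: integral_ge0.
  have iF1 : 0 <= \int[mu]_y F1 x y by exact: integral_ge0.
  have -> : \int[mu]_y H (x, y) = (x `^ (- (s / v)))%:E * \int[mu]_y F1 x y.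
    under eq_integral do rewrite HE.
    rewrite ge0_integralZl//; first exact: mF1.
    by rewrite lee_fin powR_ge0.
  apply: (@le_trans _ _ (((\int[mu]_y F1 x y) `^ v * (N `^ (1 - ka) *
      ((C1 * x `^ (- (s / (1 - u))))%:E) `^ (1 - u))) `^ v^-1)).
    apply: lee_poweR; first exact: ltW.
      exact: Tpos_ge0.
    apply: (le_trans (Tle x)).
    apply: lee_wpmul2l; first exact: poweR_ge0.
    apply: lee_wpmul2l; first exact: poweR_ge0.
    apply: lee_poweR; first exact: ltW.
      by apply: integral_ge0 => y _; exact: F30.
    exact: F3le.
  rewrite !poweRM ?mule_ge0 ?poweR_ge0// -!poweRrM mulfV ?gt_eqF// poweRe1//.
  rewrite poweR_EFin powRM ?powR_ge0 ?(ltW C10)// -powRrM.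
  rewrite (_ : - (s / (1 - u)) * ((1 - u) / v) = - (s / v))%R; last first.
    by rewrite mulNr mulrA divfK// gt_eqF.
  by rewrite EFinM [leLHS]muleC -!muleA.
apply: (@le_trans _ _ (\int[mu]_x ((N `^ ((1 - ka) / v) * (C1 `^ ((1 - u) / v))%:E) *
  \int[mu]_y H (x, y)))).
  by apply: ge0_le_integral_nonmeas => x _; rewrite ?poweR_ge0.
rewrite ge0_integralZl//; last 3 first.
- exact: (@measurable_fun_fubini_tonelli_F _ _ _ _ _ mu H).
- by move=> x _; apply: integral_ge0 => y _; exact: H0.
- by rewrite mule_ge0 ?poweR_ge0// lee_fin powR_ge0.
have -> : \int[mu]_x \int[mu]_y H (x, y) = \int[mu]_y \int[mu]_x H (x, y).
  exact: (@fubini_tonelli _ _ _ _ _ mu mu H).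
(* The beta integral in x yields y^(al/ka - s/v), which cancels the powers of y coming from the
   kernel and from the weight in [F1]; only the integrand of [N] remains. *)
have inner y : \int[mu]_x H (x, y) <= C2%:E * (g y `^ u^-1)%:E.
  have [y0|y0] := leP y 0%R.
    rewrite integral0_eq ?mule_ge0 ?lee_fin ?powR_ge0 ?(ltW C20)// => x _.
    by rewrite HE /F1 kr0 ?mul0r ?mule0// negb_and -leNgt y0.
  apply: (@le_trans _ _ (\int[mu]_x ((g y `^ u^-1 * (y `^ (s / v) * y `^ (- (al / ka))))%:E *
    ((if y < x then x `^ (- (be / ka + s / v)) * (x - y) `^ (- (la / ka)) else 0)%R)%:E))).
    apply: ge0_le_integral_nonmeas => x _; first exact: H0.
    rewrite /H -EFinM lee_fin/=; case: ifPn => [yx|h]; last by rewrite kr0 ?y0// mul0r !mulr0.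
    have x0 : (0 < x)%R by exact: lt_trans yx.
    rewrite kr// opprD -[in leRHS]pd// le_eqVlt; apply/orP; left; apply/eqP; ring.
  rewrite ge0_integralZl//; last 3 first.
  - apply/measurable_EFinP; apply: measurable_fun_ifT => //.
      by apply: measurable_fun_ltr.
    by apply: measurable_funM; [exact: measurable_fun_powR_comp|apply:
      measurable_fun_powR_comp; exact: measurable_funB].
  - by move=> x _; rewrite lee_fin; case: ifP => // _; rewrite mulr_ge0 ?powR_ge0.
  - by rewrite lee_fin !mulr_ge0 ?powR_ge0.
  apply: (@le_trans _ _ ((g y `^ u^-1 * (y `^ (s / v) * y `^ (- (al / ka))))%:E * (C2 * y `^
    (1 - (be / ka + s / v) - la / ka))%:E)).
    by apply: lee_wpmul2l; [rewrite lee_fin !mulr_ge0 ?powR_ge0|exact: HC2].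
  rewrite -!EFinM lee_fin.
  rewrite (_ : g y `^ u^-1 * _ * _ = C2 * g y `^ u^-1 *
    (y `^ (s / v) * y `^ (- (al / ka)) * y `^ (1 - (be / ka + s / v) - la / ka)))%R; last by
      ring.
  rewrite !pd// (_ : s / v - al / ka + _ = 0)%R ?powRr0 ?mulr1//.
  have -> : (1 = al / ka + be / ka + la / ka)%R by rewrite -!mulrDl -kaE divff// gt_eqF.
  ring.
apply: (@le_trans _ _ ((N `^ ((1 - ka) / v) * (C1 `^ ((1 - u) / v))%:E) * (C2%:E * N))).
  apply: lee_wpmul2l; first by rewrite mule_ge0 ?poweR_ge0// lee_fin powR_ge0.
  rewrite /N -ge0_integralZl//; last 2 first.
  - by move=> y _; rewrite lee_fin powR_ge0.
  - by rewrite lee_fin ltW.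
  apply: ge0_le_integral_nonmeas => y _; last exact: inner.
  by apply: integral_ge0.
(* Since u = v + (1 - ka), the power (1 - ka)/v of [N] from Hölder and the power 1 from Tonelli
   combine to u/v. *)
have -> : (u / v = (1 - ka) / v + 1)%R.
  by rewrite -{2}(mulfV (lt0r_neq0 v0)) -mulrDl; congr (_ / _)%R; rewrite /v; ring.
have e0 : (0 < (1 - ka) / v)%R by rewrite divr_gt0// subr_gt0.
rewrite poweRD ?poweRe1//; last by rewrite add_neq0_poweRD_def// gt_eqF// addr_gt0.
by rewrite (muleC (N `^ _) _%:E) muleACA -EFinM.
Qed.

End young.

(* [pnorm u g] is the L_p norm of [g] for p = 1/u, and [Upos_norm v g] is the L_q norm
   of [Upos g] for q = 1/v. *)
Definition pnorm {R : realType} (u : R) (g : R -> R) : \bar R :=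
  poweR (\int[lebesgue_measure]_y (g y `^ u^-1)%:E)%E u.

Definition Upos_norm {R : realType} (al be la v : R) (g : R -> R) : \bar R :=
  poweR (\int[lebesgue_measure]_x poweR (Upos al be la g x) v^-1)%E v.

(** Vanishing on the nonpositive half-line makes integrals over [Rplus] and over the whole line
    agree. *)
Definition nnfun {R : realType} (g : R -> R) : Prop :=
  [/\ measurable_fun [set: R] g, (forall y, 0 <= g y) & (forall y, y <= 0 -> g y = 0)].

(** * Interpolation of the positive operator between two exponents *)

Section interpolation.
Context {R : realType}.
Variables al be la : R.
Local Notation mu := (@lebesgue_measure R).
Local Notation kern := (Ukern al be la).
Local Notation Tpos := (Upos al be la).
Local Notation Tnorm := (Upos_norm al be la).
Local Notation ka := (kappa al be la).
Local Open Scope ereal_scope.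

Lemma nnfun_powR (p : R) (g : R -> R) : (0 < p)%R -> nnfun g -> nnfun (fun y => g y `^ p)%R.
Proof.
move=> p0 [mg g0 gn]; split.
- exact: measurable_fun_powR_comp.
- by move=> y; exact: powR_ge0.
- by move=> y /gn ->; rewrite powR0// gt_eqF.
Qed.

Lemma pnorm_powR (u w : R) (g : R -> R) : (0 < w)%R -> (forall y, 0 <= g y)%R ->
  pnorm w (fun y => g y `^ (w / u))%R = (\int[mu]_y (g y `^ u^-1)%:E) `^ w.
Proof.
move=> w0 g0; apply: (congr1 (fun z => z `^ w)); apply: eq_integral => y _.
by rewrite -powRrM mulrAC mulfV ?mul1r ?gt_eqF.
Qed.

(** Positivity replaces complex interpolation: h = f^t g^(1-t) with f = h^(u0/u) and g = h^(u1/u),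
    so Hölder in y bounds T h pointwise by (T f)^t (T g)^(1-t), and a second Hölder in x bounds the
    norm. *)
Lemma Tnorm_powR_interp (t u0 u1 : R) (h : R -> R) : (0 < t < 1)%R ->
  (0 < u0)%R -> (0 < u1)%R -> (0 < u0 + ka - 1)%R -> (0 < u1 + ka - 1)%R -> nnfun h ->
  let u := (t * u0 + (1 - t) * u1)%R in
  is_true (Tnorm (u + ka - 1) h <=
    Tnorm (u0 + ka - 1) (fun y => h y `^ (u0 / u))%R `^ t *
    Tnorm (u1 + ka - 1) (fun y => h y `^ (u1 / u))%R `^ (1 - t)).
Proof.
move=> t01 u00 u10; set v0 := (u0 + ka - 1)%R; set v1 := (u1 + ka - 1)%R.
move=> v00 v10 nh u.
have /andP[t0 t1] := t01; have t10 : (0 < 1 - t)%R by rewrite subr_gt0.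
have u_gt0 : (0 < u)%R by rewrite addr_gt0// mulr_gt0.
have vE : (u + ka - 1 = t * v0 + (1 - t) * v1)%R by rewrite /u /v0 /v1; ring.
set v := (u + ka - 1)%R in vE *.
have v_gt0 : (0 < v)%R by rewrite vE addr_gt0// mulr_gt0.
set f := (fun y => h y `^ (u0 / u))%R; set g := (fun y => h y `^ (u1 / u))%R.
have [mf f0 _] : nnfun f by apply: nnfun_powR => //; rewrite divr_gt0.
have [mg g0 _] : nnfun g by apply: nnfun_powR => //; rewrite divr_gt0.
have [mh h0 hn] := nh.
have Tf0 x : 0 <= Tpos f x by exact: Tpos_ge0.
have Tg0 x : 0 <= Tpos g x by exact: Tpos_ge0.
have mk (k : R -> R) x : measurable_fun [set: R] k -> measurable_fun [set: R] (fun y => (kern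
  x y * k y)%:E).
  by move=> mk; apply/measurable_EFinP; apply: measurable_funM => //; exact: measurable_kernl.
have Th x : Tpos h x <= Tpos f x `^ t * Tpos g x `^ (1 - t).
  apply: (le_trans _ (ge0_hoelder_interp _ _ mu t (fun y => (kern x y * f y)%:E)
    (fun y => (kern x y * g y)%:E) t01 (mk _ _ mf) (mk _ _ mg) _ _)); last 2 first.
  - by move=> y; rewrite lee_fin mulr_ge0// kern_ge0.
  - by move=> y; rewrite lee_fin mulr_ge0// kern_ge0.
  apply: ge0_le_integral_nonmeas => y _; first by rewrite lee_fin mulr_ge0// kern_ge0.
  rewrite !poweR_EFin -EFinM lee_fin !powRM ?kern_ge0//.
  rewrite mulrACA -powRD ?subrKC ?oner_eq0// powRr1 ?kern_ge0//.
  rewrite ler_wpM2l ?kern_ge0// /f /g -!powRrM.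
  have E : (u0 / u * t + u1 / u * (1 - t) = 1)%R.
    transitivity ((t * u0 + (1 - t) * u1) / u)%R; first by ring.
    by rewrite -/u mulfV ?gt_eqF.
  by rewrite -powRD E ?oner_eq0// powRr1.
(* The weight for Hölder in x: it solves s/v0 = t/v, while (1 - s)/v1 = (1 - t)/v. *)
pose s := (t * v0 / v)%R.
have sC : (1 - s = (1 - t) * v1 / v)%R.
  by rewrite /s -{1}(mulfV (lt0r_neq0 v_gt0)) -mulrBl; congr (_ / _)%R; rewrite vE; ring.
have s01 : (0 < s < 1)%R.
  by rewrite divr_gt0 ?mulr_gt0//= -subr_gt0 sC divr_gt0// mulr_gt0.
pose A := \int[mu]_x (Tpos f x `^ v0^-1); pose B := \int[mu]_x (Tpos g x `^ v1^-1).
have A0 : 0 <= A by apply: integral_ge0 => x _; exact: poweR_ge0.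
have B0 : 0 <= B by apply: integral_ge0 => x _; exact: poweR_ge0.
have iT : \int[mu]_x (Tpos h x `^ v^-1) <= A `^ s * B `^ (1 - s).
  apply: (le_trans _ (ge0_hoelder_interp _ _ mu s (fun x => Tpos f x `^ v0^-1)
    (fun x => Tpos g x `^ v1^-1) s01 _ _ _ _)); last 4 first.
  - by apply: measurable_fun_poweR; exact: measurable_Tpos.
  - by apply: measurable_fun_poweR; exact: measurable_Tpos.
  - by move=> x; exact: poweR_ge0.
  - by move=> x; exact: poweR_ge0.
  apply: ge0_le_integral_nonmeas => x _; first exact: poweR_ge0.
  apply: (@le_trans _ _ ((Tpos f x `^ t * Tpos g x `^ (1 - t)) `^ v^-1)).
    apply: lee_poweR => //; first by rewrite invr_ge0 ltW.
    exact: Tpos_ge0.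
  rewrite poweRM ?poweR_ge0// -!poweRrM sC /s.
  rewrite (_ : v0^-1 * (t * v0 / v) = t / v)%R; last first.
    by rewrite mulrA mulrCA mulVf ?mulr1// gt_eqF.
  rewrite (_ : v1^-1 * ((1 - t) * v1 / v) = (1 - t) / v)%R//.
  by rewrite mulrA mulrCA mulVf ?mulr1// gt_eqF.
rewrite /Upos_norm.
apply: (@le_trans _ _ ((A `^ s * B `^ (1 - s)) `^ v)).
  apply: lee_poweR; [exact: ltW| |exact: iT].
  by apply: integral_ge0 => x _; exact: poweR_ge0.
rewrite poweRM ?poweR_ge0// -!poweRrM sC /s !divfK ?gt_eqF//.
by rewrite (mulrC t) (mulrC (1 - t)%R).
Qed.

(** The norms of h^(u0/u) and h^(u1/u) are the powers N^u0 and N^u1 of one integral N, so they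
    recombine into N^u. With c0 and c1 the values of K, this is the log-convexity of K in 1/p. *)
Lemma Tpos_interp (t u0 u1 c0 c1 : R) (h : R -> R) : (0 < t < 1)%R ->
  (0 < u0)%R -> (0 < u1)%R -> (0 < u0 + ka - 1)%R -> (0 < u1 + ka - 1)%R ->
  (0 <= c0)%R -> (0 <= c1)%R ->
  (forall g, nnfun g -> pnorm u0 g < +oo -> Tnorm (u0 + ka - 1) g <= c0%:E * pnorm u0 g) ->
  (forall g, nnfun g -> pnorm u1 g < +oo -> Tnorm (u1 + ka - 1) g <= c1%:E * pnorm u1 g) ->
  let u := (t * u0 + (1 - t) * u1)%R in
  nnfun h -> pnorm u h < +oo ->
  Tnorm (u + ka - 1) h <= (c0 `^ t * c1 `^ (1 - t))%:E * pnorm u h.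
Proof.
move=> t01 u00 u10 v00 v10 c00 c10 H0 H1 u nh hoo.
have /andP[t0 t1] := t01; have t10 : (0 < 1 - t)%R by rewrite subr_gt0.
have u_gt0 : (0 < u)%R by rewrite addr_gt0// mulr_gt0.
have [mh h0 _] := nh.
set N := \int[mu]_y (h y `^ u^-1)%:E.
have N0 : 0 <= N by apply: integral_ge0 => y _; rewrite lee_fin powR_ge0.
have Noo : N < +oo by apply: (lty_poweRy _ hoo); rewrite gt_eqF.
have bound w c : (0 < w)%R -> (0 < w + ka - 1)%R ->
    (forall g, nnfun g -> pnorm w g < +oo -> Tnorm (w + ka - 1) g <= c%:E * pnorm w g) ->
    Tnorm (w + ka - 1) (fun y => h y `^ (w / u))%R <= c%:E * N `^ w.
  move=> w0 _; have <- : pnorm w (fun y => h y `^ (w / u))%R = N `^ w by exact: pnorm_powR.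
  move=> Hw; apply: Hw; first by apply: nnfun_powR nh; rewrite divr_gt0.
  by rewrite pnorm_powR//; exact: poweR_lty.
apply: (le_trans (Tnorm_powR_interp t u0 u1 h t01 u00 u10 v00 v10 nh)).
apply: (@le_trans _ _ ((c0%:E * N `^ u0) `^ t * (c1%:E * N `^ u1) `^ (1 - t))).
  apply: lee_pmul; [exact: poweR_ge0|exact: poweR_ge0| |].
  - by apply: lee_poweR; [exact: ltW|exact: poweR_ge0|exact: bound].
  - by apply: lee_poweR; [exact: ltW|exact: poweR_ge0|exact: bound].
clear H0 H1 bound.
rewrite !poweRM ?poweR_ge0// -!poweRrM !poweR_EFin muleACA -EFinM.
by rewrite -poweRD ?add_neq0_poweRD_def// ?(mulrC u0) ?(mulrC u1) ?gt_eqF.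
Qed.

End interpolation.

(** * From the signed operator on the half-line to the positive one *)

Definition absfun {R : realType} (f : R -> R) (y : R) : R := if 0 < y then `|f y| else 0.

Section operator.
Context {R : realType}.
Variables al be la : R.
Local Notation mu := (@lebesgue_measure R).
Local Notation Tpos := (Upos al be la).
Local Notation Tnorm := (Upos_norm al be la).
Local Notation U := (Uop al be la).
Local Open Scope ereal_scope.

Lemma RplusE (x : R) : @Rplus R x = (0 < x)%R.
Proof. by rewrite /Rplus /= in_itv/= andbT. Qed.

Lemma measurable_Rplus : measurable (@Rplus R : set (measurableTypeR R)).
Proof. exact: measurable_itv. Qed.

Lemma measurable_Rplus_restrict (f : R -> R) :
  measurable_fun (@Rplus R) f -> measurable_fun [set: R] (f \_ (@Rplus R)).
Proof. by move=> mf; apply/(measurable_restrictT f measurable_Rplus); exact: mf. Qed.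

Lemma nnfun_absfun (f : R -> R) : measurable_fun (@Rplus R) f -> nnfun (absfun f).
Proof.
move=> mf; split.
- rewrite (_ : absfun f = (fun y => `|f y|%R) \_ (@Rplus R)); last first.
    apply/funext => y; rewrite /absfun patchE; case: ifPn => y0; case: ifPn => //.
    + by rewrite notin_setE RplusE y0.
    + by rewrite inE RplusE (negbTE y0).
  by apply: measurable_Rplus_restrict; exact: measurableT_comp.
- by move=> y; rewrite /absfun; case: ifP.
- by move=> y y0; rewrite /absfun ltNge y0.
Qed.

Lemma absfun_id (g : R -> R) : nnfun g -> absfun g = g.
Proof.
case=> _ g0 gn; apply/funext => y; rewrite /absfun; case: ltP => y0.
  by rewrite ger0_norm.
by rewrite gn.
Qed.

Lemma lpnorm_absfun (p : R) (f : R -> R) : (0 < p)%R ->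
  lpnorm p f = pnorm p^-1 (absfun f).
Proof.
move=> p0; rewrite /lpnorm /pnorm invrK; apply: (congr1 (fun z => z `^ p^-1)).
rewrite integral_mkcond; apply: eq_integral => y _.
rewrite patchE /absfun; case: ifPn => [|].
  by rewrite inE RplusE => ->.
by rewrite notin_setE RplusE => /negP/negbTE ->; rewrite powR0 ?gt_eqF.
Qed.

Lemma lpnorm_nnfun (p : R) (g : R -> R) : (0 < p)%R -> nnfun g ->
  lpnorm p g = pnorm p^-1 g.
Proof. by move=> p0 ng; rewrite (lpnorm_absfun _ _ p0) (absfun_id _ ng). Qed.

Lemma Tpos_itv (g : R -> R) (x : R) : (0 < x)%R -> nnfun g ->
  Tpos g x = (x `^ (- be))%:E *
    \int[mu]_(y in `]0%R, x[) (y `^ (- al) * g y * (`|x - y| `^ (- la)))%:E.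
Proof.
move=> x0 [mg g0 _].
rewrite -ge0_integralZl//; last 3 first.
- apply/measurable_EFinP; apply: measurable_funTS; apply: measurable_funM.
    by apply: measurable_funM => //; exact: measurable_powR.
  apply: (measurable_fun_powR_comp _ (fun y : R => `|x - y|%R)).
  by apply: measurableT_comp => //; exact: measurable_funB.
- by move=> y _; rewrite lee_fin !mulr_ge0 ?powR_ge0.
- by rewrite lee_fin powR_ge0.
rewrite integral_mkcond; apply: eq_integral => y _; rewrite patchE /Ukern.
case: ifPn => [/andP[y0 yx]|h].
  rewrite mem_set/= ?in_itv/= ?y0// -EFinM gtr0_norm ?subr_gt0//.
  by congr EFin; ring.
by rewrite memNset/= ?in_itv/= ?mul0r//; exact/negP.
Qed.

Lemma Uop_fine (g : R -> R) (x : R) : (0 < x)%R -> nnfun g -> U g x = fine (Tpos g x).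
Proof.
move=> x0 ng; rewrite (Tpos_itv _ _ x0 ng) /Uop /Rintegral.
have xb : (0 < x `^ (- be))%R by rewrite powR_gt0.
have : 0 <= \int[mu]_(y in `]0%R, x[) (y `^ (- al) * g y * (`|x - y| `^ (- la)))%:E.
  by apply: integral_ge0 => y _; rewrite lee_fin !mulr_ge0 ?powR_ge0//; case: ng.
case: (\int[mu]_(y in _) _) => [r| |] //= _.
(* When the integral is infinite, both sides take the default value 0 of [fine]. *)
by rewrite gt0_muley ?lte_fin//= mulr0.
Qed.

(** The default value 0 of [fine] at infinity can only lower the left side; this is how [Uop_le]
    covers divergent integrals. *)
Lemma normr_fine_le (x : \bar R) : (`|fine x|%R)%:E <= `|x|.
Proof. by case: x => [r| |] /=; rewrite ?lexx// normr0 leey. Qed.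

Lemma Uop_le (f : R -> R) (x : R) : (0 < x)%R -> measurable_fun (@Rplus R) f ->
  (`|U f x|%R)%:E <= Tpos (absfun f) x.
Proof.
move=> x0 mf; rewrite Tpos_itv//; last exact: nnfun_absfun.
rewrite /Uop normrM EFinM ger0_norm ?powR_ge0//.
apply: lee_wpmul2l; first by rewrite lee_fin powR_ge0.
have sub : `]0%R, x[ `<=` @Rplus R by move=> y; rewrite /Rplus/= !in_itv/= => /andP[->].
rewrite /Rintegral; apply: (le_trans (normr_fine_le _)).
apply: (le_trans (le_abse_integral _ _ _)) => //.
  apply/measurable_EFinP; apply: measurable_funM.
    apply: measurable_funM; last exact: (measurable_funS measurable_Rplus sub mf).
    by apply: measurable_funTS; exact: measurable_powR.
  apply: measurable_funTS; apply: (measurable_fun_powR_comp _ (fun y : R => `|x - y|%R)).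
  by apply: measurableT_comp => //; exact: measurable_funB.
apply: ge0_le_integral_nonmeas => y; first by rewrite abse_ge0.
rewrite /= in_itv/= => /andP[y0 yx]; rewrite lee_fin !normrM !(ger0_norm (powR_ge0 _ _)).
by rewrite /absfun y0.
Qed.

Lemma lpnorm_Uop_le (q : R) (f : R -> R) : (0 < q)%R -> measurable_fun (@Rplus R) f ->
  lpnorm q (U f) <= Tnorm q^-1 (absfun f).
Proof.
move=> q0 mf; rewrite /lpnorm /Upos_norm invrK; apply: lee_poweR.
- by rewrite invr_ge0 ltW.
- by apply: integral_ge0 => x _; rewrite lee_fin powR_ge0.
rewrite integral_mkcond; apply: ge0_le_integral_nonmeas => x _; rewrite patchE.
  by case: ifP => // _; rewrite lee_fin powR_ge0.
case: ifPn => [|_]; last exact: poweR_ge0.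
rewrite inE RplusE => x0; rewrite -poweR_EFin; apply: lee_poweR; first exact: ltW.
  by rewrite lee_fin.
exact: Uop_le.
Qed.

(** [Uop] is 0 wherever [Upos] is infinite, so mass could be lost there; a finite L_q norm of [Upos]
    makes that set null. *)
Lemma lpnorm_Uop_nnfun (q : R) (g : R -> R) : (0 < q)%R -> nnfun g ->
  Tnorm q^-1 g < +oo -> lpnorm q (U g) = Tnorm q^-1 g.
Proof.
move=> q0 ng; have [mg g0 _] := ng.
rewrite /lpnorm /Upos_norm invrK => Too; apply: (congr1 (fun z => z `^ q^-1)).
have mT : measurable_fun [set: R] (Tpos g) by exact: measurable_Tpos.
have Tg0 x : 0 <= Tpos g x by exact: Tpos_ge0.
have ioo : \int[mu]_x (Tpos g x `^ q) < +oo by apply: (lty_poweRy _ Too); rewrite gt_eqF//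
  invr_gt0.
have -> : \int[mu]_(x in @Rplus R) (`|U g x| `^ q)%:E = \int[mu]_x ((fine (Tpos g x)) `^ q)%:E.
  rewrite integral_mkcond; apply: eq_integral => x _; rewrite patchE.
  case: ifPn => [|].
    by rewrite inE RplusE => x0; rewrite Uop_fine// ger0_norm// fine_ge0.
  rewrite notin_setE RplusE => /negP; rewrite -leNgt => x0.
  by rewrite Tpos_le0//= powR0// gt_eqF.
have mTq : measurable_fun [set: R] (fun x => Tpos g x `^ q) by exact: measurable_fun_poweR.
apply: ge0_ae_eq_integral => //.
- apply/measurable_EFinP; apply: measurable_fun_powR_comp.
  by apply: measurableT_comp => //; exact: measurable_fine.
- by move=> x _; rewrite lee_fin powR_ge0.
- by move=> x _; exact: poweR_ge0.
have iT : mu.-integrable [set: R] (fun x => Tpos g x `^ q).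
  apply/integrableP; split => //.
  by under eq_integral do rewrite gee0_abs ?poweR_ge0//.
have := integrable_ae measurableT iT.
apply: filterS => x /(_ I); rewrite ge0_fin_numE ?poweR_ge0// => h _.
have xoo : Tpos g x < +oo by apply: (lty_poweRy _ h); rewrite gt_eqF.
by rewrite -poweR_EFin fineK// ge0_fin_numE.
Qed.

End operator.

(** * The constant K *)

Section kconst.
Context {R : realType}.
Variables al be la : R.
Local Notation mu := (@lebesgue_measure R).
Local Notation Tnorm := (Upos_norm al be la).
Local Notation U := (Uop al be la).
Local Notation ka := (kappa al be la).
Local Notation K := (Kconst al be la).
Local Open Scope ereal_scope.

Lemma integral_itv_gt0 (f : R -> \bar R) (a b : R) : (a < b)%R ->
  measurable_fun [set: R] f -> (forall x, 0 <= f x) ->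
  (forall x, (a < x < b)%R -> 0 < f x) -> 0 < \int[mu]_x f x.
Proof.
move=> ab mf f0 fp; rewrite lt0e integral_ge0// andbT; apply/eqP => i0.
have [N [mN N0 sN]] : {ae mu, forall x, [set: R] x -> f x = 0}.
  apply/(@ae_eq_integral_abs _ _ _ mu _ measurableT f mf).
  by rewrite -i0; apply: eq_integral => x _; rewrite gee0_abs.
have : mu `]a, b[%classic <= mu N.
  apply: le_measure; rewrite ?inE//= => x; rewrite /= in_itv/= => xab.
  by apply: sN => /= /(_ I) h; have := fp _ xab; rewrite h ltxx.
by rewrite N0 lebesgue_measure_itv/= lte_fin ab -EFinD lee_fin leNgt subr_gt0 ab.
Qed.

Lemma pnorm_ge0 (u : R) (g : R -> R) : 0 <= pnorm u g.
Proof. exact: poweR_ge0. Qed.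

Lemma Tnorm_ge0 (v : R) (g : R -> R) : 0 <= Tnorm v g.
Proof. exact: poweR_ge0. Qed.

Lemma pnorm_eq0 (u w : R) (g : R -> R) : (0 < u)%R -> (0 < w)%R -> nnfun g ->
  pnorm u g = 0 -> pnorm w g = 0.
Proof.
move=> u0 w0 [mg g0 _] /poweR_eq0_eq0 H.
have m s : measurable_fun [set: R] (fun y => (g y `^ s)%:E).
  by apply/measurable_EFinP; exact: measurable_fun_powR_comp.
have {}H : \int[mu]_y (g y `^ u^-1)%:E = 0.
  by apply: H; apply: integral_ge0 => y _; rewrite lee_fin powR_ge0.
have ae0 : {ae mu, forall x, [set: R] x -> (g x `^ u^-1)%:E = 0}.
  apply/(@ae_eq_integral_abs _ _ _ mu _ measurableT _ (m _)).
  by rewrite -H; apply: eq_integral => x _; rewrite gee0_abs// lee_fin powR_ge0.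
rewrite /pnorm (_ : \int[mu]_y (g y `^ w^-1)%:E = 0) ?poweR0r ?gt_eqF//.
transitivity (\int[mu]_y `|(g y `^ w^-1)%:E|).
  by apply: eq_integral => x _; rewrite gee0_abs// lee_fin powR_ge0.
apply/(@ae_eq_integral_abs _ _ _ mu _ measurableT _ (m _)).
have [N [mN N0 sN]] := ae0; exists N; split => // x /= nP.
apply: sN => /= P; apply: nP => /= _; have [/powR_eq0_eq0 ->] := P I.
by rewrite powR0// gt_eqF// invr_gt0.
Qed.

Hypotheses (al0 : (0 < al)%R) (be0 : (0 < be)%R) (la0 : (0 < la)%R) (ka1 : (ka < 1)%R).

Lemma Tnorm_bounded (u : R) : (1 - ka < u < 1 - al)%R -> exists2 C : R, (0 < C)%R &
  forall g, nnfun g -> Tnorm (u + ka - 1) g <= C%:E * pnorm u g.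
Proof.
move=> uu; have [C C0 HC] := Tpos_young al be la al0 be0 la0 u ka1 uu.
have v0 : (0 < u + ka - 1)%R by case/andP: uu => h _; rewrite subr_gt0 -ltrBlDr.
exists (C `^ (u + ka - 1))%R; first exact: powR_gt0.
move=> g [mg g0 _]; rewrite /Upos_norm.
apply: (@le_trans _ _ ((C%:E * (\int[mu]_y (g y `^ u^-1)%:E) `^ (u / (u + ka - 1))) `^ (u +
  ka - 1))).
  apply: lee_poweR; [exact: ltW| |exact: HC].
  by apply: integral_ge0 => x _; exact: poweR_ge0.
by rewrite poweRM ?poweR_ge0 ?lee_fin ?(ltW C0)// -poweRrM divfK ?gt_eqF.
Qed.

Lemma Kconst_le (u C : R) : (0 < u)%R -> (0 < u + ka - 1)%R ->
  (forall g, nnfun g -> pnorm u g < +oo -> Tnorm (u + ka - 1) g <= C%:E * pnorm u g) ->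
  K u^-1 <= C%:E.
Proof.
move=> u0 v0 HC.
have qE : qofp al be la u^-1 = (u + ka - 1)^-1%R by rewrite /qofp invrK.
have q0 : (0 < (u + ka - 1)^-1)%R by rewrite invr_gt0.
have p0 : (0 < u^-1)%R by rewrite invr_gt0.
apply: ge_ereal_sup => _ [f [mf [foo fn0]] <-].
move: foo fn0; rewrite lpnorm_absfun// invrK qE => foo fn0.
have := HC _ (nnfun_absfun f mf) foo.
have := lpnorm_Uop_le al be la _ f q0 mf; rewrite invrK => h1 h2.
have {h1 h2} := le_trans h1 h2.
move: fn0 foo (pnorm_ge0 u (absfun f)); case: (pnorm u (absfun f)) => [n| |]// fn0 _ n0.
rewrite inver -[n == 0%R]eqe (negbTE fn0) lee_pdivrMr//.
by rewrite -lte_fin lt0e fn0.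
Qed.

(** This replaces the quotients of [Kconst], built from [Uop], by an operator bound for [Upos]. The
    a priori bound [Tnorm_bounded] comes first, because the two norms are identified only when
    finite. That K is positive and finite makes [inve] a genuine inverse when the weight [psi_K] is
    divided out. *)
Lemma Kconst_spec (u : R) : (1 - ka < u < 1 - al)%R -> exists c : R,
  [/\ (0 < c)%R, K u^-1 = c%:E &
   forall g, nnfun g -> pnorm u g < +oo -> Tnorm (u + ka - 1) g <= c%:E * pnorm u g].
Proof.
move=> uu; have [C C0 HC] := Tnorm_bounded u uu.
have v0 : (0 < u + ka - 1)%R by case/andP: uu => h _; rewrite subr_gt0 -ltrBlDr.
have u0 : (0 < u)%R by case/andP: uu => h _; apply: lt_trans h; rewrite subr_gt0.
have qE : qofp al be la u^-1 = (u + ka - 1)^-1%R by rewrite /qofp invrK.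
have q0 : (0 < (u + ka - 1)^-1)%R by rewrite invr_gt0.
have p0 : (0 < u^-1)%R by rewrite invr_gt0.
have Kub : K u^-1 <= C%:E by apply: Kconst_le => // g ng _; exact: HC.
have Klb g : nnfun g -> pnorm u g < +oo -> pnorm u g != 0 ->
    Tnorm (u + ka - 1) g <= K u^-1 * pnorm u g.
  move=> ng goo gn0.
  have Too : Tnorm (u + ka - 1) g < +oo.
    apply: (le_lt_trans (HC _ ng)); move: goo (pnorm_ge0 u g); case: (pnorm u g) => [n| |]//=
      _ _.
    by rewrite -EFinM ltry.
  have : lpnorm (qofp al be la u^-1) (U g) * inve (lpnorm u^-1 g) <= K u^-1.
    apply: ereal_sup_ubound; exists g => //; split.
      by apply: measurable_funTS; case: ng.
    by rewrite lpnorm_nnfun// invrK.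
  rewrite (lpnorm_nnfun _ g p0 ng) qE lpnorm_Uop_nnfun ?invrK//.
  move: goo gn0 (pnorm_ge0 u g); case: (pnorm u g) => [n| |]// _ gn0 n0.
  by rewrite inver -[n == 0%R]eqe (negbTE gn0) lee_pdivrMr// -lte_fin lt0e gn0.
(* A test function for positivity of K: its norm is 1 for every exponent, and its image is positive
   on (0, 1). *)
pose g1 (y : R) : R := \1_(`]0%R, 1%R[%classic) y.
have ng1 : nnfun g1.
  split.
  - exact: measurable_indic.
  - by move=> y; rewrite /g1 indicE.
  - by move=> y y0; rewrite /g1 indicE memNset//= in_itv/= ltNge y0.
have ig1 : \int[mu]_y (g1 y `^ u^-1)%:E = 1.
  transitivity (\int[mu]_y (g1 y)%:E).
    apply: eq_integral => y _; rewrite /g1 indicE; case: (_ \in _) => /=.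
      by rewrite powR1.
    by rewrite powR0// gt_eqF.
  by rewrite integral_indic//= setIT lebesgue_measure_itv/= lte_fin ltr01 oppr0 adde0.
have gg1 : pnorm u g1 = 1 by rewrite /pnorm ig1 poweR1r.
have Tg1 : 0 < Tnorm (u + ka - 1) g1.
  have [mg1 g10 _] := ng1.
  apply: poweR_gt0; apply: (integral_itv_gt0 _ 0%R 1%R ltr01).
  - by apply: measurable_fun_poweR; exact: measurable_Tpos.
  - by move=> x; exact: poweR_ge0.
  move=> x /andP[x0 x1]; apply: poweR_gt0; apply: (integral_itv_gt0 _ 0%R x x0).
  - by apply/measurable_EFinP; apply: measurable_funM => //; exact: measurable_kernl.
  - by move=> y; rewrite lee_fin mulr_ge0// kern_ge0.
  move=> y /andP[y0 yx]; rewrite lte_fin mulr_gt0//.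
    by apply: kern_gt0; rewrite y0.
  by rewrite /g1 indicE mem_set//= in_itv/= y0 (lt_trans yx).
have Kgt0 : 0 < K u^-1.
  by apply: (lt_le_trans Tg1); rewrite -[leRHS]mule1 -gg1; apply: Klb; rewrite ?gg1 ?ltry
    ?onee_neq0.
have Kfin : K u^-1 \is a fin_num by rewrite ge0_fin_numE ?(ltW Kgt0)// (le_lt_trans Kub)// ltry.
exists (fine (K u^-1)); split.
- by rewrite fine_gt0// Kgt0 -ge0_fin_numE// ltW.
- by rewrite fineK.
- move=> g ng goo; rewrite fineK//.
  (* The supremum defining K ranges over functions of nonzero norm; for zero norm the a priori bound
     already gives a zero image. *)
  have [g0|g0] := eqVneq (pnorm u g) 0; last exact: Klb.
  by rewrite g0 mule0; have := HC _ ng; rewrite g0 mule0.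
Qed.

End kconst.

(** * Functions that are nearly extremal *)

(** One index truncates both height and support, so that a single n bounds the norms at all
    exponents. *)
Definition cutoff {R : realType} (n : nat) (h : R -> R) (y : R) : R :=
  if y < n%:R then Num.min (h y) n%:R else 0.

Section cutoff.
Context {R : realType}.
Variables al be la : R.
Local Notation mu := (@lebesgue_measure R).
Local Notation kern := (Ukern al be la).
Local Notation Tpos := (Upos al be la).
Local Notation Tnorm := (Upos_norm al be la).
Local Open Scope ereal_scope.

Lemma cutoff_ge0 n (h : R -> R) y : (0 <= h y)%R -> (0 <= cutoff n h y)%R.
Proof. by move=> h0; rewrite /cutoff; case: ifP => // _; rewrite le_min h0 ler0n. Qed.

Lemma cutoff_le n (h : R -> R) y : (0 <= h y)%R -> (cutoff n h y <= h y)%R.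
Proof. by move=> h0; rewrite /cutoff; case: ifP => // _; rewrite ge_min lexx. Qed.

Lemma cutoff_le_nat n (h : R -> R) y : (cutoff n h y <= n%:R)%R.
Proof. by rewrite /cutoff; case: ifP => // _; rewrite ge_min lexx orbT. Qed.

Lemma cutoff_nd (h : R -> R) y m n : (0 <= h y)%R -> (m <= n)%N -> (cutoff m h y <= cutoff n
  h y)%R.
Proof.
move=> h0 mn; have mn' : (m%:R <= n%:R :> R)%R by rewrite ler_nat.
rewrite /cutoff; case: ifPn => ym; last first.
  by case: ifPn => // _; rewrite le_min h0 ler0n.
by rewrite (lt_le_trans ym mn') le_min !ge_min lexx/= mn' orbT.
Qed.

Lemma cutoff_eq (h : R -> R) y n : (`|h y| + `|y| < n%:R)%R -> cutoff n h y = h y.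
Proof.
move=> hn; rewrite /cutoff.
have -> : (y < n%:R)%R by apply: le_lt_trans hn; rewrite (le_trans (ler_norm _))// lerDr.
by rewrite min_l// ltW//; apply: le_lt_trans hn; rewrite (le_trans (ler_norm _))// lerDl.
Qed.

Lemma nnfun_cutoff n (h : R -> R) : nnfun h -> nnfun (cutoff n h).
Proof.
move=> [mh h0 hn]; split.
- apply: measurable_fun_ifT => //; first exact: measurable_fun_ltr.
  by apply: measurable_minr.
- by move=> y; exact: cutoff_ge0.
- by move=> y y0; rewrite /cutoff hn// min_l ?ler0n//; case: ifP.
Qed.

Lemma pnorm_cutoff_le n (h : R -> R) (u : R) : (0 < u)%R -> nnfun h -> pnorm u (cutoff n h)
  <= pnorm u h.
Proof.
move=> u0 [mh h0 hn]; apply: lee_poweR; first exact: ltW.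
  by apply: integral_ge0 => y _; rewrite lee_fin powR_ge0.
apply: ge0_le_integral_nonmeas => y _; rewrite lee_fin ?powR_ge0//.
apply: ge0_ler_powR; rewrite ?nnegrE ?invr_ge0 ?(ltW u0) ?cutoff_ge0//.
exact: cutoff_le.
Qed.

(** Height n on an interval of length n gives n * n^u, and u <= 1 removes the dependence on u. This
    uniformity controls the exponents far from b. *)
Lemma pnorm_cutoff_bounded n (h : R -> R) (u : R) : (0 < n)%N -> (0 < u <= 1)%R -> nnfun h ->
  pnorm u (cutoff n h) <= (n%:R * n%:R)%:E.
Proof.
move=> n0 /andP[u0 u1] nh; have [mh h0 hn] := nh.
have [mt t0 tn] := nnfun_cutoff n h nh.
have nn : (0 < n%:R :> R)%R by rewrite ltr0n.
have n1 : (1 <= n%:R :> R)%R by rewrite ler1n.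
apply: (@le_trans _ _ (((n%:R `^ u^-1)%:E * n%:R%:E) `^ u)).
  apply: lee_poweR; first exact: ltW.
    by apply: integral_ge0 => y _; rewrite lee_fin powR_ge0.
  apply: (@le_trans _ _ (\int[mu]_(y in `]0%R, n%:R[) (n%:R `^ u^-1)%:E)).
    rewrite [leRHS]integral_mkcond; apply: ge0_le_integral_nonmeas => y _.
      by rewrite lee_fin powR_ge0.
    rewrite patchE; case: ifPn => [_|].
      rewrite lee_fin; apply: ge0_ler_powR; rewrite ?nnegrE ?invr_ge0 ?(ltW u0) ?ler0n
        ?cutoff_ge0//.
      exact: cutoff_le_nat.
    rewrite notin_setE/= in_itv/= => /negP; rewrite negb_and -!leNgt => /orP[y0|yn].
      by rewrite tn// powR0// gt_eqF// invr_gt0.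
    by rewrite /cutoff ltNge yn/= powR0// gt_eqF// invr_gt0.
  by rewrite integral_cst//= lebesgue_measure_itv/= lte_fin nn oppr0 adde0.
rewrite -EFinM poweR_EFin lee_fin powRM ?powR_ge0 ?ler0n// -powRrM mulVf ?gt_eqF// powRr1
  ?ler0n//.
rewrite ler_pM2l//.
by apply: ler1_powR.
Qed.

(** Monotone limits are suprema, and x -> x^r is an order isomorphism of [0, +oo] with inverse x ->
    x^(1/r), so it carries suprema to suprema, infinite ones included. *)
Lemma nd_poweR_cvg (a : nat -> \bar R) (l : \bar R) (r : R) : (0 < r)%R ->
  (forall n, 0 <= a n) -> nondecreasing_seq a -> a @ \oo --> l ->
  (fun n => a n `^ r) @ \oo --> l `^ r.
Proof.
move=> r0 a0 nda al'.
have al_le n : a n <= l.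
  have <- : ereal_sup (range a) = l.
    by rewrite -(cvg_lim _ al')//; apply/esym/cvg_lim => //; exact: ereal_nondecreasing_cvgn.
  by apply: ereal_sup_ubound; exists n.
have l0 : 0 <= l by apply: le_trans (al_le 0%N).
have ndp : nondecreasing_seq (fun n => a n `^ r).
  by move=> m n mn; apply: lee_poweR; [exact: ltW| |exact: nda].
have cp := ereal_nondecreasing_cvgn ndp.
suff <- : ereal_sup (range (fun n => a n `^ r)) = l `^ r by exact: cp.
set b := ereal_sup _; apply/eqP; rewrite eq_le; apply/andP; split.
  by apply: ge_ereal_sup => _ [n _ <-]; apply: lee_poweR; [exact: ltW| |].
have b0 : 0 <= b by apply: (le_trans (poweR_ge0 (a 0%N) r)); apply: ereal_sup_ubound; exists
  0%N.
have lb : l <= b `^ r^-1.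
  rewrite -(cvg_lim _ al')//; apply: lime_le; first by apply/cvg_ex; exists l.
  apply: nearW => n; rewrite -(poweRe1 (a0 n)) -(mulfV (lt0r_neq0 r0)) poweRrM.
  apply: lee_poweR; [by rewrite invr_ge0 ltW|exact: poweR_ge0|].
  by apply: ereal_sup_ubound; exists n.
rewrite -[leRHS](poweRe1 b0) -(mulVf (lt0r_neq0 r0)) poweRrM.
by apply: lee_poweR; [exact: ltW| |].
Qed.

Lemma Tpos_cutoff_nd (h : R -> R) x : nnfun h -> nondecreasing_seq (fun n => Tpos (cutoff n
  h) x).
Proof.
move=> [mh h0 hn] m n mn; apply: ge0_le_integral_nonmeas => y _.
  by rewrite lee_fin mulr_ge0 ?kern_ge0 ?cutoff_ge0.
by rewrite lee_fin ler_wpM2l ?kern_ge0// cutoff_nd.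
Qed.

Lemma Tpos_cutoff_cvg (h : R -> R) x : nnfun h -> Tpos (cutoff n h) x @[n --> \oo] --> Tpos h x.
Proof.
move=> nh; have [mh h0 hn] := nh.
have E : Tpos h x = \int[mu]_y limn (fun n => (kern x y * cutoff n h y)%:E).
  apply: eq_integral => y _; apply/esym/cvg_lim => //; apply: cvg_near_cst.
  near=> n; rewrite cutoff_eq//; near: n; exact: nbhs_infty_gtr.
rewrite E; apply: cvg_monotone_convergence => //.
- move=> n; apply/measurable_EFinP; apply: measurable_funM; first exact: measurable_kernl.
  by case: (nnfun_cutoff n h nh).
- by move=> n y _; rewrite lee_fin mulr_ge0 ?kern_ge0 ?cutoff_ge0.
- by move=> y _ m n mn; rewrite lee_fin ler_wpM2l ?kern_ge0// cutoff_nd.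
Unshelve. all: by end_near. Qed.

(** Monotone convergence, in y for the operator and then in x for the norm. Read contrapositively: a
    strict lower bound for the image of h already holds for some cut-off. *)
Lemma Tnorm_cutoff_le (v : R) (h : R -> R) (L : \bar R) : (0 < v)%R -> nnfun h -> 0 <= L ->
  (forall n, Tnorm v (cutoff n h) <= L) -> Tnorm v h <= L.
Proof.
move=> v0 nh L0 H; have [mh h0 hn] := nh.
have T0 n x : 0 <= Tpos (cutoff n h) x.
  by apply: Tpos_ge0 => y; exact: cutoff_ge0.
have vi : (0 < v^-1)%R by rewrite invr_gt0.
have E : \int[mu]_x (Tpos h x `^ v^-1) = \int[mu]_x limn (fun n => Tpos (cutoff n h) x `^ v^-1).
  apply: eq_integral => x _; apply/esym/cvg_lim => //.
  by apply: nd_poweR_cvg => //; [exact: Tpos_cutoff_nd|exact: Tpos_cutoff_cvg].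
have C : \int[mu]_x (Tpos (cutoff n h) x `^ v^-1) @[n --> \oo] --> \int[mu]_x (Tpos h x `^
  v^-1).
  rewrite E; apply: cvg_monotone_convergence => //.
  - move=> n; have [mt t0 _] := nnfun_cutoff n h nh.
    by apply: measurable_fun_poweR; exact: measurable_Tpos.
  - by move=> n x _; exact: poweR_ge0.
  - move=> x _ m n mn; apply: lee_poweR; [exact: ltW|exact: T0|exact: Tpos_cutoff_nd].
have : \int[mu]_x (Tpos h x `^ v^-1) <= L `^ v^-1.
  rewrite -(cvg_lim _ C)//; apply: lime_le; first by apply/cvg_ex; eexists; exact: C.
  apply: nearW => n; have := H n; rewrite /Upos_norm => Hn.
  rewrite -[leLHS]poweRe1; last by apply: integral_ge0 => x _; exact: poweR_ge0.
  rewrite -(mulfV (lt0r_neq0 v0)) poweRrM.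
  by apply: lee_poweR => //; [exact: ltW|exact: poweR_ge0].
move=> h1; rewrite /Upos_norm -(poweRe1 L0) -(mulVf (lt0r_neq0 v0)) poweRrM.
apply: lee_poweR => //; first exact: ltW.
by apply: integral_ge0 => x _; exact: poweR_ge0.
Qed.

End cutoff.

Section near_extremal.
Context {R : realType}.
Variables al be la : R.
Local Notation mu := (@lebesgue_measure R).
Local Notation Tpos := (Upos al be la).
Local Notation Tnorm := (Upos_norm al be la).
Local Notation ka := (kappa al be la).
Local Notation K := (Kconst al be la).
Local Open Scope ereal_scope.

(** Lyapunov's inequality: the L_(1/w) norm is log-convex in w. Extended-real F makes it serve both
    g and [Upos] of g. *)
Lemma integral_poweR_interp (t w0 w1 : R) (F : R -> \bar R) : (0 < t < 1)%R ->
  (0 < w0)%R -> (0 < w1)%R -> measurable_fun [set: R] F -> (forall x, 0 <= F x) ->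
  (\int[mu]_x (F x `^ (t * w0 + (1 - t) * w1)^-1)) `^ (t * w0 + (1 - t) * w1) <=
  ((\int[mu]_x (F x `^ w0^-1)) `^ w0) `^ t * ((\int[mu]_x (F x `^ w1^-1)) `^ w1) `^ (1 - t).
Proof.
move=> t01 w00 w10 mF F0; set w := (t * w0 + (1 - t) * w1)%R; have /andP[t0 t1] := t01.
have t10 : (0 < 1 - t)%R by rewrite subr_gt0.
have wp : (0 < w)%R by rewrite addr_gt0// mulr_gt0.
pose s := (t * w0 / w)%R.
have sC : (1 - s = (1 - t) * w1 / w)%R.
  by rewrite /s -{1}(mulfV (lt0r_neq0 wp)) -mulrBl; congr (_ / _)%R; rewrite /w; ring.
have s01 : (0 < s < 1)%R.
  by rewrite divr_gt0 ?mulr_gt0//= -subr_gt0 sC divr_gt0// mulr_gt0.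
have A0 p : 0 <= \int[mu]_x (F x `^ p) by apply: integral_ge0 => x _; exact: poweR_ge0.
apply: (@le_trans _ _ (((\int[mu]_x (F x `^ w0^-1)) `^ s * (\int[mu]_x (F x `^ w1^-1)) `^ (1
  - s)) `^ w)).
  apply: lee_poweR => //; first exact: ltW.
  apply: (le_trans _ (ge0_hoelder_interp _ _ mu s (fun x => F x `^ w0^-1)
    (fun x => F x `^ w1^-1) s01 _ _ _ _)); last 4 first.
  - exact: measurable_fun_poweR.
  - exact: measurable_fun_poweR.
  - by move=> x; exact: poweR_ge0.
  - by move=> x; exact: poweR_ge0.
  apply: ge0_le_integral_nonmeas => x _; first exact: poweR_ge0.
  rewrite -!poweRrM sC /s.
  rewrite (_ : w0^-1 * (t * w0 / w) = t / w)%R; last first.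
    by rewrite mulrA mulrCA mulVf ?mulr1// gt_eqF.
  rewrite (_ : w1^-1 * ((1 - t) * w1 / w) = (1 - t) / w)%R; last first.
    by rewrite mulrA mulrCA mulVf ?mulr1// gt_eqF.
  have E : (t / w + (1 - t) / w = w^-1)%R by rewrite -mulrDl addrC subrK mul1r.
  by rewrite -[in leLHS]E poweRD// add_neq0_poweRD_def// E gt_eqF// invr_gt0.
rewrite poweRM ?poweR_ge0// -!poweRrM sC /s !divfK ?gt_eqF//.
by rewrite (mulrC t) (mulrC (1 - t)%R).
Qed.

Lemma pnorm_interp (t w0 w1 : R) (g : R -> R) : (0 < t < 1)%R ->
  (0 < w0)%R -> (0 < w1)%R -> nnfun g ->
  pnorm (t * w0 + (1 - t) * w1)%R g <= pnorm w0 g `^ t * pnorm w1 g `^ (1 - t).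
Proof.
move=> t01 w00 w10 [mg g0 _].
apply: (integral_poweR_interp t w0 w1 (fun y => (g y)%:E)) => //.
by apply/measurable_EFinP.
Qed.

Lemma Tnorm_interp (t w0 w1 : R) (g : R -> R) : (0 < t < 1)%R ->
  (0 < w0)%R -> (0 < w1)%R -> nnfun g ->
  Tnorm (t * w0 + (1 - t) * w1)%R g <= Tnorm w0 g `^ t * Tnorm w1 g `^ (1 - t).
Proof.
move=> t01 w00 w10 [mg g0 _].
apply: (integral_poweR_interp t w0 w1 (Tpos g)) => //.
  exact: measurable_Tpos.
by move=> x; exact: Tpos_ge0.
Qed.

Hypotheses (al0 : (0 < al)%R) (be0 : (0 < be)%R) (la0 : (0 < la)%R) (ka1 : (ka < 1)%R).

(** Start from |f| for an f whose quotient is close to K. A cut-off keeps the strict lower bound on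
    the image and can only decrease the norm in the denominator, so the ratio survives. *)
Lemma near_extremal (u th : R) : (1 - ka < u < 1 - al)%R -> (0 < th < 1)%R ->
  exists n, exists h : R -> R, exists G : R,
  [/\ (0 < n)%N, nnfun h, (0 < G)%R, pnorm u (cutoff n h) = G%:E &
    th%:E * K u^-1 * G%:E < Tnorm (u + ka - 1) (cutoff n h)].
Proof.
move=> uu /andP[th0 th1].
have [c [c0 KE HK]] := Kconst_spec al be la al0 be0 la0 ka1 u uu.
have v0 : (0 < u + ka - 1)%R by case/andP: uu => h _; rewrite subr_gt0 -ltrBlDr.
have u0 : (0 < u)%R by case/andP: uu => h _; apply: lt_trans h; rewrite subr_gt0.
have qE : qofp al be la u^-1 = (u + ka - 1)^-1%R by rewrite /qofp invrK.
have q0 : (0 < (u + ka - 1)^-1)%R by rewrite invr_gt0.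
have p0 : (0 < u^-1)%R by rewrite invr_gt0.
have : (th * c)%:E < K u^-1 by rewrite KE lte_fin gtr_pMl.
move=> /ereal_sup_gt[_ [f [mf [foo fn0]] <-]].
move: foo fn0; rewrite lpnorm_absfun// invrK qE => foo fn0.
have nh := nnfun_absfun f mf; set h := absfun f in foo fn0 nh *.
have [G GE] : exists G, pnorm u h = G%:E.
  by exists (fine (pnorm u h)); rewrite fineK// ge0_fin_numE ?pnorm_ge0.
have G0 : (0 < G)%R by rewrite -lte_fin -GE lt0e fn0 pnorm_ge0.
rewrite GE inver (gt_eqF G0) lte_pdivlMr// => lowU.
have lowT : (th * c * G)%:E < Tnorm (u + ka - 1) h.
  rewrite EFinM; apply: (lt_le_trans lowU).
  by have := lpnorm_Uop_le al be la _ f q0 mf; rewrite invrK.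
have [n Hn] : exists n, (th * c * G)%:E < Tnorm (u + ka - 1) (cutoff n h).
  apply: contrapT => /forallNP H; move: lowT; apply/negP; rewrite -leNgt.
  apply: Tnorm_cutoff_le => //; first by rewrite lee_fin !mulr_ge0 ?ltW.
  by move=> n; rewrite leNgt; apply/negP; exact: H.
have nt := nnfun_cutoff n h nh.
have gle : pnorm u (cutoff n h) <= G%:E by rewrite -GE; exact: pnorm_cutoff_le.
have goo : pnorm u (cutoff n h) < +oo by apply: (le_lt_trans gle); rewrite ltry.
have [G' GE'] : exists G', pnorm u (cutoff n h) = G'%:E.
  by exists (fine (pnorm u (cutoff n h))); rewrite fineK// ge0_fin_numE ?pnorm_ge0.
(* A cut-off of zero norm would have an image of zero norm by [HK], against [Hn]. *)
have G'0 : (0 < G')%R.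
  rewrite -lte_fin -GE' lt0e pnorm_ge0 andbT; apply/eqP => z.
  have := HK _ nt goo; rewrite z mule0 => /(lt_le_trans Hn).
  by rewrite lte_fin ltNge !mulr_ge0 ?ltW.
exists n, h, G'; split; [ |exact: nh|exact: G'0|exact: GE'| ].
- case: n {Hn nt gle goo} GE' => // GE'.
  move: G'0; rewrite -lte_fin -GE' /pnorm integral0_eq ?poweR0r ?gt_eqF ?ltxx// => y _.
  rewrite /cutoff; case: ifPn => [_|_]; last by rewrite powR0// gt_eqF.
  by rewrite min_r ?powR0 ?gt_eqF//; case: nh.
- rewrite KE -!EFinM; apply: le_lt_trans Hn.
  by rewrite lee_fin ler_pM2l ?mulr_gt0// -lee_fin -GE'.
Qed.

End near_extremal.

Section near_extremal_right.
Context {R : realType}.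
Variables al be la : R.
Local Notation Tnorm := (Upos_norm al be la).
Local Notation ka := (kappa al be la).
Local Notation K := (Kconst al be la).
Local Open Scope ereal_scope.

Lemma ge0_EFin (x : \bar R) : 0 <= x -> x < +oo -> exists2 r, (0 <= r)%R & x = r%:E.
Proof. by case: x => [r| |]// r0 _; exists r. Qed.

Hypotheses (al0 : (0 < al)%R) (be0 : (0 < be)%R) (la0 : (0 < la)%R) (ka1 : (ka < 1)%R).

(* For u = s u0 + (1 - s) ub, log-convexity bounds K(1/u) and [pnorm u g] from above by
   interpolation between ub and u0, and the norm of [Upos g] at u from below by
   extrapolation from u1 < ub and ub. All these bounds tend to their values at ub as
   s tends to 0. *)
Lemma near_extremal_right (ub u0 th' : R) : (1 - ka < ub)%R -> (ub < u0)%R ->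
  (u0 < 1 - al)%R -> (0 < th' < 1)%R ->
  exists n, exists h : R -> R, exists ud : R,
  [/\ (0 < n)%N, nnfun h, pnorm ub (cutoff n h) != 0, (ub < ud <= u0)%R &
    forall u, (ub < u < ud)%R ->
    th'%:E * (K u^-1 * pnorm u (cutoff n h)) <= Tnorm (u + ka - 1) (cutoff n h)].
Proof.
move=> kub ub0 u0a /andP[th'0 th'1].
(* The gap between th' and th pays for moving away from [ub]; on the logarithmic scale it is the [e]
   below. *)
have [th thth' th1] : exists2 th : R, (th' < th)%R & (th < 1)%R.
  by exists ((th' + 1) / 2)%R; rewrite midf_lt.
have th0 : (0 < th)%R by exact: lt_trans thth'.
have uub : (1 - ka < ub < 1 - al)%R by rewrite kub (lt_trans ub0).
have uu0 : (1 - ka < u0 < 1 - al)%R by rewrite (lt_trans kub).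
have ka1' : (0 < 1 - ka)%R by rewrite subr_gt0.
have ub_gt0 : (0 < ub)%R by exact: lt_trans kub.
have u0_gt0 : (0 < u0)%R by exact: lt_trans ub0.
have [|n [h [G [n0 nh G0 GE Tlow]]]] := near_extremal al be la al0 be0 la0 ka1 ub th uub.
  by rewrite th0.
set g := cutoff n h in GE Tlow *.
have ng : nnfun g by exact: nnfun_cutoff.
have [cb [cb0 KbE HKb]] := Kconst_spec al be la al0 be0 la0 ka1 ub uub.
have [c0 [c00 K0E HK0]] := Kconst_spec al be la al0 be0 la0 ka1 u0 uu0.
(* The second point of the extrapolation: any point of the finite range of K to the left of [ub]
   would do. *)
pose u1 := ((1 - ka + ub) / 2)%R.
have ku1 : (1 - ka < u1)%R by rewrite midf_lt.
have u1b : (u1 < ub)%R by rewrite midf_lt.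
have vpos u : (1 - ka < u)%R -> (0 < u + ka - 1)%R by rewrite ltrBlDr -subr_gt0.
have u1_gt0 : (0 < u1)%R by exact: lt_trans ku1.
have u01 : (u0 < 1)%R by apply: lt_trans u0a _; rewrite gtrBl.
have M0 : (0 < n%:R * n%:R :> R)%R by rewrite mulr_gt0 ?ltr0n.
have gM u : (0 < u < 1)%R -> pnorm u g <= (n%:R * n%:R)%:E.
  by move=> /andP[a b]; apply: pnorm_cutoff_bounded => //; rewrite a ltW.
have goo u : (0 < u < 1)%R -> pnorm u g < +oo.
  by move=> /gM /le_lt_trans; apply; rewrite ltry.
have Tfin u : (1 - ka < u < 1 - al)%R -> exists2 T, (0 <= T)%R & Tnorm (u + ka - 1) g = T%:E.
  move=> uu; have [C C0 HC] := Tnorm_bounded al be la al0 be0 la0 ka1 u uu.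
  apply: ge0_EFin; first exact: Tnorm_ge0.
  apply: (le_lt_trans (HC _ ng)).
  have [gu _ ->] : exists2 r, (0 <= r)%R & pnorm u g = r%:E.
    apply: ge0_EFin; first exact: pnorm_ge0.
    apply: goo; case/andP: uu => a b; rewrite (lt_trans ka1' a)/=.
    by apply: lt_trans b _; rewrite gtrBl.
  by rewrite -EFinM ltry.
have [Tb _ TbE] := Tfin ub uub.
have [T1 T10 T1E] := Tfin u1 (introT andP (conj ku1 (lt_trans u1b (lt_trans ub0 u0a)))).
rewrite TbE KbE -!EFinM lte_fin in Tlow.
have Y0 : (0 < cb * G)%R by rewrite mulr_gt0.
have X0 : (0 < c0 * (n%:R * n%:R))%R by rewrite mulr_gt0.
have Tb0 : (0 < Tb)%R by exact: (lt_trans (mulr_gt0 (mulr_gt0 th0 cb0) G0) Tlow).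
(* [T1] is only known to be nonnegative; adding 1 lets its logarithm be taken. *)
have T1p : (0 < T1 + 1)%R by rewrite ltr_wpDl.
pose m := ((u0 - ub) / (ub - u1))%R.
have b1 : (0 < ub - u1)%R by rewrite subr_gt0.
have b0 : (0 < u0 - ub)%R by rewrite subr_gt0.
have m0 : (0 < m)%R by rewrite divr_gt0.
pose lX := ln (c0 * (n%:R * n%:R))%R; pose lY := ln (cb * G)%R.
pose lT := ln Tb; pose l1 := ln (T1 + 1)%R.
pose e := (ln th - ln th')%R.
have e0 : (0 < e)%R by rewrite subr_gt0 ltr_ln ?posrE.
(* Inside the absolute value stands the slope in s of the final comparison of logarithms: the upper
   interpolation contributes lX - lY, the lower extrapolation m (lT - l1). *)
pose D := `|lX - lY - m * lT + m * l1|%R.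
have D0 : (0 <= D)%R by exact: normr_ge0.
have De : (0 < D + e)%R by rewrite ltr_wpDl.
have lTlow : (ln th + lY < lT)%R.
  by rewrite /lY /lT -lnM ?posrE// ltr_ln ?posrE ?mulr_gt0// mulrA.
(* For u below this endpoint, s < e / (D + e), hence s D < e; adding e in the denominator covers D =
   0. *)
exists n, h, (ub + e / (D + e) * (u0 - ub))%R; split => //.
- by rewrite GE eqe gt_eqF.
- rewrite ltrDl mulr_gt0 ?divr_gt0//= -lerBrDl ler_piMl ?(ltW b0)//.
  by rewrite ler_pdivrMr// mul1r lerDr.
move=> u /andP[ubu uud]; rewrite -/g.
pose s := ((u - ub) / (u0 - ub))%R.
have s0 : (0 < s)%R by rewrite divr_gt0// subr_gt0.
have se : (s < e / (D + e))%R by rewrite ltr_pdivrMr// ltrBlDl.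
have s1 : (s < 1)%R by apply: lt_le_trans se _; rewrite ler_pdivrMr// mul1r lerDr.
have uE : (u = s * u0 + (1 - s) * ub)%R.
  rewrite (_ : s * u0 + (1 - s) * ub = s * (u0 - ub) + ub)%R; last by ring.
  by rewrite /s divfK ?gt_eqF// subrK.
have s01 : (0 < s < 1)%R by rewrite s0.
have uuu : (1 - ka < u < 1 - al)%R.
  rewrite (lt_trans kub)//=; apply: lt_trans u0a.
  by rewrite uE -subr_gt0 (_ : _ - _ = (1 - s) * (u0 - ub))%R; [rewrite mulr_gt0//
    subr_gt0|ring].
have [T T0 TE] := Tfin u uuu.
have u_gt0 : (0 < u)%R by exact: lt_trans ubu.
have u_lt1 : (u < 1)%R by case/andP: uuu => _ b; apply: lt_trans b _; rewrite gtrBl.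
have Kle : K u^-1 <= (c0 `^ s * cb `^ (1 - s))%:E.
  apply: Kconst_le => //; first by apply: vpos; case/andP: uuu.
  move=> k nk koo; move: koo; rewrite uE; apply: (Tpos_interp al be la s u0 ub c0 cb k) => //.
  - by apply: vpos; case/andP: uu0.
  - exact: vpos.
  - exact: ltW.
  - exact: ltW.
have gle : pnorm u g <= ((n%:R * n%:R) `^ s * G `^ (1 - s))%:E.
  rewrite {1}uE; apply: (le_trans (pnorm_interp s u0 ub g s01 u0_gt0 ub_gt0 ng)).
  rewrite EFinM -!poweR_EFin -GE; apply: lee_wpmul2r; first exact: poweR_ge0.
  by apply: lee_poweR; [exact: ltW|exact: pnorm_ge0|apply: gM; rewrite u0_gt0].
apply: (@le_trans _ _ (th'%:E * ((c0 `^ s * cb `^ (1 - s))%:E * ((n%:R * n%:R) `^ s * G `^ (1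
  - s))%:E))).
  apply: lee_wpmul2l; first by rewrite lee_fin ltW.
  apply: lee_pmul => //; last exact: pnorm_ge0.
  have [c [c_gt0 -> _]] := Kconst_spec al be la al0 be0 la0 ka1 u uuu.
  by rewrite lee_fin ltW.
rewrite TE -!EFinM lee_fin.
rewrite mulrACA -!powRM ?(ltW c00) ?(ltW cb0) ?(ltW G0) ?(ltW M0)//.
(* Chosen so that ub = t u + (1 - t) u1: convexity at the middle point [ub] then becomes a lower
   bound at its right neighbour u. *)
pose t := (1 + s * m)^-1%R.
have sm0 : (0 < s * m)%R by rewrite mulr_gt0.
have sm1 : (0 < 1 + s * m)%R by rewrite addr_gt0.
have t01 : (0 < t < 1)%R by rewrite invr_gt0 sm1/= invf_lt1// ltrDl.
have t1E : (1 - t = s * m * t)%R.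
  by rewrite -{1}(mulfV (lt0r_neq0 sm1)) -/t; ring.
have ubE : (ub + ka - 1 = t * (u + ka - 1) + (1 - t) * (u1 + ka - 1))%R.
  have H : (ub - u1 = t * (u - u1))%R.
    have -> : (u - u1 = (1 + s * m) * (ub - u1))%R.
      have mE : (m * (ub - u1) = u0 - ub)%R by rewrite divfK// gt_eqF.
      have sE : (s * (u0 - ub) = u - ub)%R by rewrite divfK// gt_eqF.
      by rewrite mulrDl mul1r -[(s * m * _)%R]mulrA mE sE; ring.
    by rewrite mulrA mulVf ?mul1r// gt_eqF.
  rewrite -[LHS](subrK (u1 + ka - 1)%R) (_ : ub + ka - 1 - (u1 + ka - 1) = ub - u1)%R; last
    by ring.
  rewrite H; ring.
have TbT : (Tb <= T `^ t * (T1 + 1) `^ (1 - t))%R.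
  have := Tnorm_interp al be la t (u + ka - 1) (u1 + ka - 1) g t01
    (vpos _ (proj1 (andP uuu))) (vpos _ ku1) ng.
  rewrite -ubE TbE TE T1E !poweR_EFin -EFinM lee_fin => /le_trans; apply.
  rewrite ler_wpM2l ?powR_ge0//; apply: ge0_ler_powR; rewrite ?nnegrE//.
  - by case/andP: t01 => _ t1; rewrite subr_ge0 ltW.
  - exact: ltW.
  - by rewrite lerDl ler01.
have Tp : (0 < T)%R.
  rewrite lt0r T0 andbT; apply/eqP => z; move: TbT.
  rewrite z powR0 ?mul0r; first by rewrite leNgt Tb0.
  by case/andP: t01 => t0 _; rewrite gt_eqF.
(* Logarithms of [TbT], multiplied by 1/t = 1 + s m. *)
have lnT : (lT + s * m * (lT - l1) <= ln T)%R.
  have : (lT <= t * ln T + (1 - t) * l1)%R.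
    by rewrite /lT /l1 -!ln_powR -lnM ?posrE ?powR_gt0// ler_ln ?posrE// mulr_gt0 ?powR_gt0.
  rewrite t1E -(ler_pM2r sm1) (_ : (t * ln T + s * m * t * l1) * (1 + s * m) =
    (t * (1 + s * m)) * (ln T + s * m * l1))%R; last by ring.
  rewrite mulVf ?gt_eqF// mul1r; move: (s * m)%R => z; lra.
rewrite -ler_ln ?posrE ?mulr_gt0 ?powR_gt0//.
rewrite !lnM ?posrE ?mulr_gt0 ?powR_gt0// !ln_powR -/lX -/lY.
apply: le_trans lnT.
have sD : (s * D < e)%R.
  have : (s * (D + e) < e)%R by rewrite -ltr_pdivlMr.
  by rewrite mulrDr; apply: le_lt_trans; rewrite lerDl mulr_ge0 ?ltW.
have sD2 : (s * (lX - lY - m * lT + m * l1) <= s * D)%R.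
  by rewrite ler_pM2l// ler_norm.
move: sD sD2 lTlow; rewrite /e; move: (s * D)%R => z h1 h2 h3.
have -> : (ln th' + (s * lX + (1 - s) * lY) =
   s * (lX - lY - m * lT + m * l1) + (ln th' + lY) + s * m * (lT - l1))%R by ring.
rewrite lerD2r; lra.
Qed.

End near_extremal_right.

(** * Dilations and the grand norms *)

Section dilation.
Context {R : realType}.
Variables al be la : R.
Local Notation mu := (@lebesgue_measure R).
Local Notation kern := (Ukern al be la).
Local Notation Tpos := (Upos al be la).
Local Notation Tnorm := (Upos_norm al be la).
Local Notation ka := (kappa al be la).
Local Open Scope ereal_scope.
Variables (tau : R) (tau0 : (0 < tau)%R).

Lemma ge0_integral_dilation (h : R -> \bar R) : measurable_fun [set: R] h ->
  (forall x, 0 <= h x) -> \int[mu]_x h (tau * x)%R = (tau^-1)%:E * \int[mu]_x h x.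
Proof.
move=> mh h0; rewrite (@ge0_integral_affine _ tau 0%R h)// muleA -EFinM mulVf ?gt_eqF// mul1e.
by apply: eq_integral => x _; rewrite addr0.
Qed.

Lemma nnfun_dilation (g : R -> R) : nnfun g -> nnfun (fun y => g (tau * y)%R).
Proof.
move=> [mg g0 gn]; split => //.
- by apply: (measurableT_comp mg); exact: measurable_funM.
- by move=> y y0; apply: gn; rewrite pmulr_rle0.
Qed.

Lemma pnorm_dilation (u : R) (g : R -> R) : nnfun g ->
  pnorm u (fun y => g (tau * y)%R) = (tau `^ (- u))%:E * pnorm u g.
Proof.
move=> [mg g0 _]; rewrite /pnorm (ge0_integral_dilation (fun y => (g y `^ u^-1)%:E)).
- rewrite poweRM ?lee_fin ?invr_ge0 ?(ltW tau0)//; last first.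
    by apply: integral_ge0 => y _; rewrite lee_fin powR_ge0.
  by rewrite poweR_EFin -(powR_inv1 (ltW tau0)) -powRrM mulN1r.
- by apply/measurable_EFinP; exact: measurable_fun_powR_comp.
- by move=> y; rewrite lee_fin powR_ge0.
Qed.

Lemma kern_dilation (x y : R) : kern (tau * x) (tau * y) = (tau `^ (- ka) * kern x y)%R.
Proof.
rewrite /Ukern pmulr_rgt0// ltr_pM2l//; case: ifPn => [/andP[y0 yx]|_]; last by rewrite mulr0.
have x0 : (0 < x)%R by exact: lt_trans yx.
rewrite -mulrBr !powRM ?(ltW tau0) ?(ltW x0) ?(ltW y0) ?subr_ge0 ?(ltW yx)//.
have -> : (- ka = - be + (- al + - la))%R by rewrite /kappa; ring.
have tn : (tau == 0%R) = false by rewrite gt_eqF.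
by rewrite !powRD ?tn ?implybT//; ring.
Qed.

Lemma Tpos_dilation (g : R -> R) (x : R) : nnfun g ->
  Tpos (fun y => g (tau * y)%R) x = (tau `^ (ka - 1))%:E * Tpos g (tau * x)%R.
Proof.
move=> [mg g0 _].
have mk z : measurable_fun [set: R] (fun y => (kern z y * g y)%:E).
  by apply/measurable_EFinP; apply: measurable_funM => //; exact: measurable_kernl.
have k0 z y : 0 <= (kern z y * g y)%:E by rewrite lee_fin mulr_ge0 ?kern_ge0.
have E : \int[mu]_y (kern (tau * x) (tau * y) * g (tau * y))%:E = (tau^-1)%:E * Tpos g (tau *
  x)%R.
  exact: (ge0_integral_dilation (fun y => (kern (tau * x)%R y * g y)%:E)).
have -> : (tau `^ (ka - 1) = tau `^ ka * tau^-1)%R.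
  by rewrite powRD ?(gt_eqF tau0) ?implybT// powR_inv1 ?ltW.
rewrite EFinM -muleA -E -ge0_integralZl//; last 2 first.
- apply/measurable_EFinP; apply: measurable_funM.
    by apply: (measurableT_comp (measurable_kernl _ _ _ _)); exact: measurable_funM.
  by apply: (measurableT_comp mg); exact: measurable_funM.
- by rewrite lee_fin powR_ge0.
apply: eq_integral => y _; rewrite -EFinM kern_dilation; congr EFin.
by rewrite !mulrA -powRD ?(gt_eqF tau0) ?implybT// subrr powRr0 mul1r.
Qed.

(** The operator contributes tau^(ka - 1) and the L_q norm tau^(-v). As v = u + ka - 1, the product
    is tau^(-u), the same factor as in [pnorm_dilation], so quotients are invariant. *)
Lemma Tnorm_dilation (u : R) (g : R -> R) : (0 < u + ka - 1)%R -> nnfun g ->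
  Tnorm (u + ka - 1) (fun y => g (tau * y)%R) = (tau `^ (- u))%:E * Tnorm (u + ka - 1) g.
Proof.
move=> v0 ng; have [mg g0 _] := ng; set v := (u + ka - 1)%R in v0 *.
have T0 x : 0 <= Tpos g x by exact: Tpos_ge0.
have mT : measurable_fun [set: R] (fun x => Tpos g x `^ v^-1).
  by apply: measurable_fun_poweR; exact: measurable_Tpos.
have i0 : 0 <= \int[mu]_x (Tpos g x `^ v^-1) by apply: integral_ge0 => x _; exact: poweR_ge0.
rewrite /Upos_norm.
have -> : \int[mu]_x (Tpos (fun y => g (tau * y)%R) x `^ v^-1) =
    ((tau `^ (ka - 1)) `^ v^-1)%:E * ((tau^-1)%:E * \int[mu]_x (Tpos g x `^ v^-1)).
  rewrite -(ge0_integral_dilation (fun x => Tpos g x `^ v^-1))//; last first.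
    by move=> x; exact: poweR_ge0.
  transitivity (\int[mu]_x (((tau `^ (ka - 1)) `^ v^-1)%:E * Tpos g (tau * x)%R `^ v^-1)).
    by apply: eq_integral => x _; rewrite Tpos_dilation// poweRM ?lee_fin ?powR_ge0.
  apply: (@ge0_integralZl _ _ _ mu [set: R] measurableT (fun x => Tpos g (tau * x)%R `^ v^-1)).
  - by apply: (measurableT_comp mT); exact: measurable_funM.
  - by move=> x _; exact: poweR_ge0.
  - by rewrite lee_fin powR_ge0.
have ti : (0 <= tau^-1)%R by rewrite invr_ge0 ltW.
rewrite !poweRM ?mule_ge0 ?lee_fin ?powR_ge0// !poweR_EFin muleA -EFinM; congr (_%:E * _).
rewrite -powRrM mulVf ?gt_eqF// powRr1 ?powR_ge0//.
rewrite -(powR_inv1 (ltW tau0)) -powRrM mulN1r -powRD ?(gt_eqF tau0) ?implybT//.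
by congr (_ `^ _)%R; rewrite /v; ring.
Qed.

End dilation.

Section grand_lebesgue.
Context {R : realType}.
Variables (al be la A : R) (B : \bar R) (psi : R -> R).
Hypotheses (al0 : 0 < al) (be0 : 0 < be) (la0 : 0 < la) (ka1 : kappa al be la < 1).
Hypotheses (A1 : 1 <= A) (Psi : in_Psi A B psi).
Local Notation U := (Uop al be la).
Local Notation ka := (kappa al be la).
Local Notation K := (Kconst al be la).
Local Open Scope ereal_scope.

Let kaE : ka = (al + be + la)%R. Proof. by []. Qed.

Let al1 : (0 < 1 - al)%R.
Proof. by move: (ka1) (be0) (la0); rewrite kaE => *; lra. Qed.

Let all1 : (0 < 1 - al - la)%R.
Proof. by move: (ka1) (be0) (la0); rewrite kaE => *; lra. Qed.

Let inv_range (p : R) : (pminus al < p < pplus al la)%R ->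
  (0 < p)%R /\ (1 - al - la < p^-1 < 1 - al)%R.
Proof.
move=> /andP[h1 h2]; have p0 : (0 < p)%R by apply: lt_trans h1; rewrite invr_gt0.
split=> //; apply/andP; split.
  by rewrite -[X in (X < _)%R]invrK ltf_pV2 ?posrE ?invr_gt0.
by rewrite -[X in (_ < X)%R]invrK ltf_pV2 ?posrE ?invr_gt0.
Qed.

Let kall : (1 - ka < 1 - al - la)%R.
Proof. by move: (be0); rewrite kaE => *; lra. Qed.

Let psi_gt0 p : AB A B p -> (0 < psi p)%R.
Proof. by have [_ [H _]] := Psi; exact: H. Qed.

Let psi_abE p : ab_set al la A B p -> psi_ab al la A B psi p = psi p.
Proof. by move=> abp; rewrite /psi_ab; case: asboolP. Qed.

Lemma Gnorm_Uop_le (f : R -> R) : measurable_fun (@Rplus R) f ->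
  Gnorm (AB A B) (fun p => (psi p)%:E) f < +oo ->
  Gnorm (qdom al be la A B) (psi_K al be la psi) (U f) <=
  Gnorm (ab_set al la A B) (fun p => (psi_ab al la A B psi p)%:E) f.
Proof.
move=> mf foo; apply: ge_ereal_sup => _ [q Dq <-].
set p := pofq al be la q in Dq.
have [ABp prange] := Dq; have [p0 /andP[pl pr]] := inv_range _ prange.
have psip := psi_gt0 _ ABp.
pose u := p^-1%R.
have uu : (1 - ka < u < 1 - al)%R by rewrite pr andbT; exact: lt_trans pl.
have vE : (u + ka - 1 = q^-1)%R by rewrite /u /p /pofq invrK; ring.
have q0 : (0 < q)%R by rewrite -invr_gt0 -vE subr_gt0 -ltrBlDr; case/andP: uu.
(* The bound by K is available only for f in L_p; this is what membership in G(psi) provides. *)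
have foo' : lpnorm p f < +oo.
  have : lpnorm p f * inve (psi p)%:E < +oo.
    by apply: le_lt_trans foo; apply: ereal_sup_ubound; exists p.
  rewrite inver gt_eqF//; case: (lpnorm p f) => [r| |]; rewrite ?ltry ?ltNyy//.
  by rewrite gt0_mulye ?lte_fin ?invr_gt0.
apply: (@le_trans _ _ (lpnorm p f * inve (psi p)%:E)); last first.
  by apply: ereal_sup_ubound; exists p => //=; rewrite psi_abE.
have [c [c0 KE HK]] := Kconst_spec al be la al0 be0 la0 ka1 u uu.
have -> : psi_K al be la psi q = (c * psi p)%:E.
  by rewrite /psi_K -/p EFinM -KE /u invrK.
have Ule : lpnorm q (U f) <= c%:E * lpnorm p f.
  apply: (le_trans (lpnorm_Uop_le al be la q f q0 mf)).
  rewrite -vE lpnorm_absfun// -/u; apply: HK; first exact: nnfun_absfun.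
  by rewrite /u -lpnorm_absfun.
have cp : (0 < c * psi p)%R by rewrite mulr_gt0.
rewrite !inver !gt_eqF// lee_pdivrMr//; apply: (le_trans Ule).
rewrite -muleA -EFinM mulrCA mulVf ?gt_eqF// mulr1.
by rewrite muleC.
Qed.

Lemma Gnorm_Uop_sharp (C : R) : A%:E < B -> ab_set al la A B !=set0 -> (C < 1)%R ->
  exists f : R -> R, measurable_fun (@Rplus R) f /\
    (Gnorm (AB A B) (fun p => (psi p)%:E) f < +oo /\
    C%:E * Gnorm (ab_set al la A B) (fun p => (psi_ab al la A B psi p)%:E) f <
    Gnorm (qdom al be la A B) (psi_K al be la psi) (U f)).
Proof.
move=> AltB [p0 abp0] C1.
have [c c0 cpsi] := proj2 (proj2 Psi).
(* b is the minimum of B and p_+, finite even for infinite B; the last two properties treat both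
   cases of B alike. *)
have [b [bpp bl br]] : exists b : R, [/\ (b <= pplus al la)%R,
    (forall p : R, (p < b)%R -> p%:E < B /\ (p < pplus al la)%R) &
    (forall p : R, p%:E < B -> (p < pplus al la)%R -> (p < b)%R)].
  case: (B) AltB => [r| |]// _.
    exists (Num.min r (pplus al la)); split.
    - by rewrite ge_min lexx orbT.
    - by move=> p; rewrite lt_min lte_fin => /andP[].
    - by move=> p; rewrite lt_min lte_fin => -> ->.
  exists (pplus al la); split => //.
  by move=> p ->; rewrite ltry.
have [[Ap0 p0B] p0range] := abp0.
have [p0_gt0 /andP[p0l p0r]] := inv_range _ p0range.
have p0b : (p0 < b)%R by apply: br => //; case/andP: p0range.
have b0 : (0 < b)%R by exact: lt_trans p0b.
have pp0 : (0 < pplus al la)%R by rewrite invr_gt0.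
pose ub := b^-1%R; pose u0 := p0^-1%R.
have ub0 : (0 < ub)%R by rewrite invr_gt0.
have ubu0 : (ub < u0)%R by rewrite ltf_pV2 ?posrE.
have kub : (1 - ka < ub)%R.
  apply: (lt_le_trans kall); rewrite -[leLHS]invrK.
  by rewrite lef_pV2 ?posrE.
have abE u : (ub < u <= u0)%R -> ab_set al la A B u^-1%R.
  move=> /andP[ubu uu0]; have up : (0 < u)%R by exact: lt_trans ubu.
  have h1 : (u^-1 < b)%R by rewrite -[b]invrK ltf_pV2 ?posrE.
  have h2 : (p0 <= u^-1)%R by rewrite -[p0]invrK lef_pV2 ?posrE// invr_gt0.
  have [h3 h4] := bl _ h1; split; first by split => //; exact: lt_le_trans h2.
  by apply/andP; split => //; apply: lt_le_trans h2; case/andP: p0range.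
(* C may be negative; a nonnegative C' makes [th] positive, as [near_extremal_right] requires. *)
have [C' CC' /andP[C'0 C'1]] : exists2 C' : R, (C <= C')%R & (0 <= C' < 1)%R.
  by exists (Num.max C 0%R); rewrite ?le_max ?lexx ?orbT// gt_max C1 ltr01.
have [th C'th th1] : exists2 th : R, (C' < th)%R & (th < 1)%R.
  by exists ((C' + 1) / 2)%R; rewrite midf_lt.
have th0 : (0 < th)%R by exact: le_lt_trans C'th.
have [|n [h [ud [n0 nh gub /andP[ubud udu0] near]]]] :=
  near_extremal_right al be la al0 be0 la0 ka1 ub u0 th kub ubu0 p0r.
  by rewrite th0.
set g := cutoff n h in gub near.
have ng : nnfun g by exact: nnfun_cutoff.
pose M : R := (n%:R * n%:R)%R.
have M0 : (0 < M)%R by rewrite mulr_gt0 ?ltr0n.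
have gE u : (0 < u <= 1)%R -> exists G : R, [/\ (0 < G)%R, (G <= M)%R & pnorm u g = G%:E].
  move=> /andP[up u1].
  have gM : pnorm u g <= M%:E by apply: pnorm_cutoff_bounded => //; rewrite up.
  have [G G0 GE] := ge0_EFin (pnorm u g) (pnorm_ge0 u g) (le_lt_trans gM (ltry _)).
  exists G; split => //; last by rewrite -lee_fin -GE.
  rewrite lt0r G0 andbT; apply/eqP => G00.
  by move/eqP: gub; apply; apply: (pnorm_eq0 u) => //; rewrite GE G00.
have ABinv p : AB A B p -> (0 < p)%R /\ (0 < p^-1 <= 1)%R.
  move=> [Ap _]; have p1 : (1 < p)%R by exact: le_lt_trans Ap.
  have pp : (0 < p)%R by exact: lt_trans p1.
  by split=> //; rewrite invr_gt0 pp invf_le1// ltW.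
(* A reference exponent strictly inside the near-extremal interval; dilation favours it over every u
   >= ud. *)
pose um := ((ub + ud) / 2)%R.
have um1 : (ub < um)%R by rewrite midf_lt.
have um2 : (um < ud)%R by rewrite midf_lt.
have abm : ab_set al la A B um^-1%R by apply: abE; rewrite um1 ltW// (lt_le_trans um2).
have [ABm _] := abm; have psim := psi_gt0 _ ABm.
have [_ um01] := ABinv _ ABm; rewrite invrK in um01.
have [Gm [Gm0 GmM GmE]] := gE _ um01.
pose Wm := (Gm / psi um^-1)%R.
have Wm0 : (0 < Wm)%R by rewrite divr_gt0.
(* Chosen so that X Wm = Wm + M/c: once [tau] gains the factor X between [ud] and [um], the value at
   [um] beats the uniform bound M/c at [ud] and beyond. *)
pose X := (1 + M / (c * Wm))%R.
have X1 : (1 <= X)%R by rewrite lerDl divr_ge0 ?ltW// mulr_gt0.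
have dum : (0 < ud - um)%R by rewrite subr_gt0.
pose tau := (X `^ (ud - um)^-1)%R.
have tau1 : (1 <= tau)%R.
  by rewrite -[leLHS](powRr0 X); apply: ler_powR => //; rewrite invr_ge0 ltW.
have tau0 : (0 < tau)%R by exact: lt_le_trans tau1.
have tauX : (tau `^ (ud - um) = X)%R.
  by rewrite -powRrM mulVf ?gt_eqF// powRr1// (le_trans ler01).
pose f (y : R) := g (tau * y)%R.
have nf : nnfun f by exact: nnfun_dilation.
pose W p G := (tau `^ (- p^-1) * G / psi p)%R.
have fE p : AB A B p -> exists G : R, [/\ (0 < G)%R, (G <= M)%R, pnorm p^-1 g = G%:E &
    lpnorm p f * inve (psi p)%:E = (W p G)%:E].
  move=> ABp; have [pp u01] := ABinv _ ABp.
  have [G [G0 GM GE]] := gE _ u01; exists G; split => //.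
  by rewrite lpnorm_nnfun// pnorm_dilation// GE inver gt_eqF ?psi_gt0.
have tauMc p G : AB A B p -> (0 < G)%R -> (G <= M)%R -> (W p G <= tau `^ (- p^-1) * (M / c))%R.
  move=> ABp G0 GM; rewrite /W -mulrA ler_wpM2l ?powR_ge0//.
  apply: ler_pM => //; [exact: ltW|by rewrite invr_ge0 ltW ?psi_gt0|].
  by rewrite lef_pV2 ?posrE ?psi_gt0//; exact: cpsi.
have WMc p G : AB A B p -> (0 < G)%R -> (G <= M)%R -> (W p G <= M / c)%R.
  move=> ABp G0 GM; apply: le_trans (tauMc _ _ ABp G0 GM) _.
  apply: ler_piMl; first by rewrite divr_ge0// ltW.
  rewrite -[leRHS](powRr0 tau); apply: ler_powR => //.
  by rewrite oppr_le0; have [_ /andP[/ltW]] := ABinv _ ABp.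
exists f; split; first by apply: measurable_funTS; case: nf.
split.
  apply: (@le_lt_trans _ _ (M / c)%:E); last exact: ltry.
  apply: ge_ereal_sup => _ [p ABp <-]; have [G [G0 GM _ ->]] := fE _ ABp.
  by rewrite lee_fin; exact: WMc.
set S := Gnorm (ab_set al la A B) _ f.
have Sle : S <= (M / c)%:E.
  apply: ge_ereal_sup => _ [p abp <-]; rewrite psi_abE//.
  have [ABp _] := abp; have [G [G0 GM _ ->]] := fE _ ABp.
  by rewrite lee_fin; exact: WMc.
have Sgt0 : 0 < S.
  have [G [G0 GM _ GE]] := fE _ ABm.
  apply: (@lt_le_trans _ _ (W um^-1%R G)%:E).
    by rewrite lte_fin divr_gt0// mulr_gt0// powR_gt0.
  by apply: ereal_sup_ubound; exists um^-1%R => //; rewrite psi_abE.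
have [s s0 SE] := ge0_EFin S (ltW Sgt0) (le_lt_trans Sle (ltry _)).
have sp : (0 < s)%R by rewrite -lte_fin -SE.
(* An exponent where f nearly attains S and which is close enough to b for [near]. Precision C'/th
   leaves room for the factor th lost there. *)
have [u [G [ubu G0 GE HW]]] : exists u, exists G : R,
    [/\ (ub < u < ud)%R, (0 < G)%R, pnorm u g = G%:E & (C' / th * s < W u^-1 G)%R].
  have : (C' / th * s)%:E < S.
    by rewrite SE lte_fin gtr_pMl// ltr_pdivrMr// mul1r.
  move=> /ereal_sup_gt[_ [p abp <-]]; rewrite psi_abE//.
  have [ABp prange] := abp; have [G [G0 GM GE ->]] := fE _ ABp.
  have [pp _] := ABinv _ ABp; rewrite lte_fin => HW.
  (* If p is not close to b, then by the choice of [tau] the value at 1/um is larger. *)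
  have [pud|pud] := ltP p^-1%R ud.
    exists p^-1%R, G; split => //; last by rewrite invrK.
    rewrite pud andbT ltf_pV2 ?posrE//; apply: br; first by case: ABp.
    by case/andP: prange.
  exists um, Gm; split => //; first by rewrite um1.
  apply: (lt_le_trans HW); apply: (le_trans (tauMc _ _ ABp G0 GM)).
  rewrite /W invrK -mulrA -/Wm.
  apply: (@le_trans _ _ (tau `^ (- ud) * (M / c))%R).
    apply: ler_wpM2r; first by rewrite divr_ge0// ltW.
    by apply: ler_powR => //; rewrite lerN2.
  have -> : (- um = - ud + (ud - um))%R by ring.
  rewrite powRD ?(gt_eqF tau0) ?implybT// tauX -mulrA ler_wpM2l ?powR_ge0//.
  have -> : (X * Wm = Wm + M / c)%R.
    have gen (w : R) : (0 < w)%R -> ((1 + M / (c * w)) * w = w + M / c)%R.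
      by move=> w0; field; rewrite !gt_eqF.
    exact: gen.
  by rewrite lerDr ltW.
have /andP[ubu1 uud] := ubu.
have abu : ab_set al la A B u^-1%R by apply: abE; rewrite ubu1 ltW// (lt_le_trans uud).
have [ABu urange] := abu; have psiu := psi_gt0 _ ABu.
have [_ /andP[ul ur]] := inv_range _ urange; rewrite invrK in ul ur.
have uu : (1 - ka < u < 1 - al)%R by rewrite ur andbT; exact: lt_trans ul.
have [k [k0 KE HK]] := Kconst_spec al be la al0 be0 la0 ka1 u uu.
have v0 : (0 < u + ka - 1)%R by case/andP: uu => a _; rewrite subr_gt0 -ltrBlDr.
pose q := (u + ka - 1)^-1%R.
have pqE : pofq al be la q = u^-1%R.
  by rewrite /pofq /q invrK; congr (_^-1)%R; ring.
apply: (@lt_le_trans _ _ (lpnorm q (U f) * inve (psi_K al be la psi q))); last first.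
  by apply: ereal_sup_ubound; exists q => //; rewrite /qdom /= pqE.
have fu : pnorm u f = (tau `^ (- u) * G)%:E by rewrite pnorm_dilation// GE.
rewrite lpnorm_Uop_nnfun ?invr_gt0//; last first.
  (* Finiteness of the image norm, under which the norms of [Uop] and [Upos] coincide; a lower bound
     requires this equality. *)
  rewrite invrK; apply: (le_lt_trans (HK f nf _)); rewrite fu ?ltry//.
rewrite invrK Tnorm_dilation//.
rewrite /psi_K pqE KE -EFinM inver gt_eqF ?mulr_gt0//.
rewrite lte_pdivlMr ?mulr_gt0//.
apply: (@lt_le_trans _ _ ((tau `^ (- u))%:E * (th%:E * (K u^-1 * pnorm u g)))); last first.
  by apply: lee_wpmul2l; [rewrite lee_fin powR_ge0|exact: near].
rewrite KE GE SE -!EFinM lte_fin.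
have -> : (tau `^ (- u) * (th * (k * G)) = th * W u^-1 G * (k * psi u^-1))%R.
  rewrite /W invrK -[in RHS]mulrA.
  rewrite (_ : tau `^ (- u) * G / psi u^-1 * (k * psi u^-1) =
    tau `^ (- u) * G * k * (psi u^-1 / psi u^-1))%R; last by ring.
  by rewrite mulfV ?gt_eqF// mulr1; ring.
rewrite ltr_pM2r ?mulr_gt0//.
apply: (@le_lt_trans _ _ (C' * s)%R); first by rewrite ler_wpM2r.
by move: HW; rewrite [ltLHS]mulrAC ltr_pdivrMr// => HW; rewrite [ltRHS]mulrC.
Qed.

End grand_lebesgue.

Theorem theorem4p1 (R : realType) (al be la : R) (A : R) (B : \bar R)
  (psi : R -> R) :
  0 < al < 1 -> 0 < be < 1 -> 0 < la < 1 -> kappa al be la < 1 ->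
  1 <= A -> (A%:E < B)%E -> in_Psi A B psi ->
  ab_set al la A B !=set0 ->
  (forall f : R -> R, measurable_fun (@Rplus R) f ->
     (Gnorm (AB A B) (fun p => (psi p)%:E) f < +oo)%E ->
     (Gnorm (qdom al be la A B) (psi_K al be la psi) (Uop al be la f)
      <= 1%:E * Gnorm (ab_set al la A B) (fun p => (psi_ab al la A B psi p)%:E) f)%E)
  /\
  (forall C : R, C < 1 ->
     exists f : R -> R, measurable_fun (@Rplus R) f /\
     (Gnorm (AB A B) (fun p => (psi p)%:E) f < +oo)%E /\
     (C%:E * Gnorm (ab_set al la A B) (fun p => (psi_ab al la A B psi p)%:E) f
      < Gnorm (qdom al be la A B) (psi_K al be la psi) (Uop al be la f))%E).
Proof.
move=> /andP[al0 _] /andP[be0 _] /andP[la0 _] ka1 A1 AB0 Psi ab0; split.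
  by move=> f mf foo; rewrite mul1e; exact: Gnorm_Uop_le.
by move=> C C1; exact: Gnorm_Uop_sharp.
Qed.
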